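(* Let $1\le d\le n$ be integers, let $\{\mathbf U_t\}_{t\in\mathbb N}$ be a sequence in $\operatorname{Gr}(n,d)$ and $\{u_t\}_{t\in\mathbb N}$ a sequence in $\mathbb R^n$. Let $t_0\ge d$ be an integer, $\hat{\mathbf U}_{t_0}\in\operatorname{Gr}(n,d)$, and let $T\in\{d,\dots,t_0+1\}$, $K\ge 1$ be integers. Assume: (A1) there is $\epsilon\ge 0$ such that for every $t\in\mathbb N$, $u_t=\bar u_t+e_t$ with $\bar u_t\in\mathbf U_t$ and $\|e_t\|_2\le\epsilon$; (A2) there is $c\ge 0$ such that $d_2(\mathbf U_t,\mathbf U_{t+1})\le c$ for all $t\in\mathbb N$; (A3) there are constants $0<\underline\sigma\le\overline\sigma$ such that, with $W_t=[u_{t-T+1}\ u_{t-T+2}\ \dots\ u_t]\in\mathbb R^{n\times T}$, $\sigma_1(P_{\mathbf U_t}W_t)\le\overline\sigma$ and $\sigma_d(P_{\mathbf U_t}W_t)\ge\underline\sigma$ for all integers $t\ge T$. Let $0<\alpha<\dfrac{\underline\sigma^2}{2\overline\sigma^4}$ and assume further: (A4) $\hat{\mathbf U}_{t_0}\in\mathbb B_{r_{\mathrm b}}(\mathbf U_{t_0+1})$ for some $r_{\mathrm b}$ with $c\le r_{\mathrm b}<1$, and, with $\tilde\rho:=1-4(1-r_{\mathrm b}^2)(\alpha\underline\sigma^2-2\alpha^2\overline\sigma^4)\ge 0$, $$\gamma_{r_{\mathrm b}}(\delta_t)\le(1-\tilde\rho)r_{\mathrm b}^2+\frac{(1-\tilde\rho)(c^2-2cr_{\mathrm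 b})}{1-\tilde\rho^K}$$ for all integers $t\ge t_0$ with $t\ge T$. Let $\{\hat{\mathbf U}_t\}_{t>t_0}$ be the output of the GREAT algorithm (see context) run with initial estimate $\hat{\mathbf U}_{t_0}$, samples $\{u_t\}$, window length $T$, step size $\alpha$ and $K$ inner iterations. Then $\tilde\rho\in(0,1)$, and for all integers $t\ge t_0+1$, $$d_2(\hat{\mathbf U}_t,\mathbf U_t)^2\le\tilde\rho^{K(t-t_0)}d_2(\hat{\mathbf U}_{t_0},\mathbf U_{t_0})^2+\frac{1-\tilde\rho^{K(t-t_0)}}{1-\tilde\rho}\gamma_{r_{\mathrm b}}(\|\delta\|_\infty)+\frac{1-\tilde\rho^{K(t-t_0)}}{1-\tilde\rho^K}\tilde\rho^K(2r_{\mathrm b}-c)c .$$ Consequently, $$\limsup_{t\to\infty}d_2(\hat{\mathbf U}_t,\mathbf U_t)^2\le\frac{1}{1-\tilde\rho}\gamma_{r_{\mathrm b}}(\|\delta\|_\infty)+\frac{\tilde\rho^K}{1-\tilde\rho^K}(2r_{\mathrm b}-c)c .$$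
   Context: $\mathbb N$ denotes the positive integers. $\operatorname{Gr}(n,d)$ is the Grassmann manifold of $d$-dimensional subspaces of $\mathbb R^n$. A subspace $\mathbf U\in\operatorname{Gr}(n,d)$ is represented by any $U\in\mathbb R^{n\times d}$ with $U^\top U=I_d$ whose columns span $\mathbf U$; $P_{\mathbf U}=UU^\top$ and $P_{\mathbf U}^\perp=I_n-P_{\mathbf U}$. $\sigma_i(A)$ is the $i$-th largest singular value of $A$, and $\|\cdot\|_F$ is the Frobenius norm. Chordal distance: $d_2(\mathbf U,\mathbf V)=(\mathrm{tr}(P_{\mathbf U}^\perp P_{\mathbf V}))^{1/2}=(\sum_{i=1}^d\sin^2\theta_i)^{1/2}$, where $\theta_i$ are the principal angles between $\mathbf U$ and $\mathbf V$. Metric ball: $\mathbb B_r(\mathbf U)=\{\hat{\mathbf U}\in\operatorname{Gr}(n,d): d_2(\mathbf U,\hat{\mathbf U})\le r\}$. Noise bound: for integers $t\ge T$, $$\delta_t:=c\,\|W_tD\|_F+\epsilon\sqrt T\,(c(T-1)+1),\qquad D:=\mathrm{diag}(T-1,T-2,\dots,0),$$ and $\|\delta\|_\infty=\sup_{t\ge T}|\delta_t|$. For $r\ge 0$ and $s\ge0$, $$\gamma_r(s):=8\alpha r\overline\sigma(1+4\alpha\overline\sigma^2)s+\left(4\alpha r+16\alpha^2\overline\sigma^2(r+2)\right)s^2+32\alpha^2\overline\sigma s^3+8\alpha^2s^4 .$$ Exponential map: for $\mathbf\Gamma\in\operatorname{Gr}(n,d)$ with orthonormal representation $\Gamma$,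 and a tangent vector represented by $V\in\mathbb R^{n\times d}$ with $\Gamma^\top V=0$ and compact SVD $V=Q_1\mathrm{diag}(s_1,\dots,s_d)Q_2^\top$, $\mathrm{Exp}_{\mathbf\Gamma}(V)$ is the subspace spanned by the columns of $\Gamma Q_2\,\mathrm{diag}(\cos s_i)\,Q_2^\top+Q_1\,\mathrm{diag}(\sin s_i)\,Q_2^\top$. Cost: $F_{W}(\mathbf\Gamma)=\|P_{\mathbf\Gamma}^\perp W\|_F^2$, with Riemannian gradient represented by $\mathrm{grad}\,F_W(\mathbf\Gamma)=-2P_{\mathbf\Gamma}^\perp WW^\top\Gamma$. GREAT algorithm: for $t=t_0+1,t_0+2,\dots$: form $W_t$; set $\mathbf\Gamma_0=\hat{\mathbf U}_{t-1}$; for $k=0,\dots,K-1$ set $\mathbf\Gamma_{k+1}=\mathrm{Exp}_{\mathbf\Gamma_k}(-\alpha\,\mathrm{grad}\,F_{W_t}(\mathbf\Gamma_k))$; set $\hat{\mathbf U}_t=\mathbf\Gamma_K$. *)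

(* Defs.v *)
From HB Require Import structures.
From mathcomp Require Import all_boot all_order all_algebra.
From mathcomp Require Import all_classical all_reals all_analysis.
From mathcomp Require Import polyrcf.

Set Implicit Arguments.
Unset Strict Implicit.
Unset Printing Implicit Defensive.

Import Order.TTheory GRing.Theory Num.Theory.
Local Open Scope ring_scope.

(* MathComp-Analysis norms matrices by the maximum of the entries, whence this
   separate definition; on column vectors it is the Euclidean norm. *)
Definition frob (R : realType) (m n : nat) (A : 'M[R]_(m, n)) : R :=
  Num.sqrt (\sum_i \sum_j A i j ^+ 2).

(* Eigenvalues of [A^T *m A] listed with algebraic multiplicity in
   nonincreasing order ([rootsR] is increasing and without repetition). *)
Definition gram_eigenvalues (R : realType) (m n : nat) (A : 'M[R]_(m, n)) :
    seq R :=
  let p := char_poly (A^T *m A) in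
  flatten [seq nseq (mup x p) x | x <- rev (rootsR p)].

(* Numbered from 1: [singular_value A 1] is the largest one; 0 beyond [n]. *)
Definition singular_value (R : realType) (m n : nat) (A : 'M[R]_(m, n))
    (i : nat) : R :=
  Num.sqrt (nth 0 (gram_eigenvalues A) i.-1).

Definition Gr (R : realType) (n d : nat) :=
  {U : {vspace 'cV[R]_n} | \dim U == d}.

Definition colspan (R : realType) (n d : nat) (M : 'M[R]_(n, d)) :
    {vspace 'cV[R]_n} :=
  <<[seq col j M | j <- enum 'I_d]>>%VS.

Definition orthonormal_rep (R : realType) (n d : nat) (M : 'M[R]_(n, d))
    (U : Gr R n d) : Prop :=
  M^T *m M = 1%:M /\ colspan M = val U.

(* The representative is chosen arbitrarily; [orthonormal_rep_exists] and
   [gr_projE] below show that one exists and that the choice is irrelevant. *)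
Definition gr_proj (R : realType) (n d : nat) (U : Gr R n d) : 'M[R]_n :=
  let M := xget 0 [set M | @orthonormal_rep R n d M U]%classic in M *m M^T.

Definition gr_proj_perp (R : realType) (n d : nat) (U : Gr R n d) : 'M[R]_n :=
  1%:M - gr_proj U.

Lemma colspanP (R : realType) (n d : nat) (M : 'M[R]_(n, d)) (x : 'cV[R]_n) :
  reflect (exists y, x = M *m y) (x \in colspan M).
Proof.
have mulE (y : 'cV[R]_d) : M *m y = \sum_j y j 0 *: col j M.
  apply/colP => i; rewrite !mxE summxE; apply: eq_bigr => j _.
  by rewrite !mxE mulrC.
have sz : size [seq col j M | j <- enum 'I_d] = d by rewrite size_map size_enum_ord.
apply: (iffP idP) => [|[y ->]]; last first.
  rewrite mulE; apply: memv_suml => j _; apply: memvZ; apply: memv_span.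
  by apply: map_f; rewrite mem_enum.
have -> : colspan M = <<in_tuple [seq col j M | j <- enum 'I_d]>>%VS by [].
move=> /coord_span xE.
exists (\col_j coord (in_tuple [seq col j M | j <- enum 'I_d])
                 (cast_ord (esym sz) j) x).
rewrite mulE {1}xE (reindex (cast_ord (esym sz))) /=; last first.
  by exists (cast_ord sz) => i _; [rewrite cast_ordKV | rewrite cast_ordK].
apply: eq_bigr => j _; rewrite !mxE (nth_map j) ?size_enum_ord //.
by rewrite nth_ord_enum.
Qed.

Lemma orthonormal_rep_exists (R : realType) (n d : nat) (U : Gr R n d) :
  exists M, orthonormal_rep M U.
Proof.
case: U => U dU; rewrite /orthonormal_rep /=.
elim: d U dU => [|d IH] U /eqP dU.
  exists 0; split; first by apply/matrixP => -[].
  have/eqP -> : U == 0%VS by rewrite -dimv_eq0 dU.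
  apply/eqP; rewrite -subv0; apply/subvP => x /colspanP[y ->].
  by rewrite mul0mx mem0v.
have U0 : U != 0%VS by rewrite -dimv_eq0 dU.
set v := vpick U; have vU : v \in U by apply: memv_pick.
have v0 : v != 0 by rewrite vpick0.
pose a := \sum_i v i 0 ^+ 2.
have vv : v^T *m v = a%:M.
  apply/matrixP => i j; rewrite !mxE !ord1 /= mulr1n; apply: eq_bigr => k _.
  by rewrite !mxE expr2.
have a0 : 0 < a.
  rewrite lt0r sumr_ge0 ?andbT; last by move=> k _; exact: sqr_ge0.
  apply: contra v0 => /eqP/psumr_eq0P a0; apply/eqP/colP => k; rewrite mxE.
  by apply/eqP; rewrite -sqrf_eq0 a0 // => i _; exact: sqr_ge0.
pose e := (Num.sqrt a)^-1 *: v.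
have eU : e \in U by apply: memvZ.
have ee : e^T *m e = 1%:M.
  rewrite /e (_ : (_ *: v)^T = (Num.sqrt a)^-1 *: v^T); last by apply: linearZ.
  rewrite -scalemxAl -scalemxAr vv scalerA -expr2 exprVn.
  by rewrite sqr_sqrtr ?ltW // -mul_scalar_mx -scalar_mxM mulVf ?gt_eqF.
pose f : 'Hom('cV[R]_n, 'cV[R]_1) := linfun (mulmx e^T).
have fE x : f x = e^T *m x by rewrite lfunE.
have dU' : \dim (U :&: lker f) == d.
  have := limg_ker_dim f U; rewrite dU.
  suff -> : \dim (f @: U) = 1%N by rewrite addn1 => -[->].
  apply/eqP; rewrite eqn_leq; apply/andP; split.
    by rewrite (leq_trans (dimvS (subvf _))) // dimvf.
  rewrite lt0n dimv_eq0; apply/negP => /eqP f0.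
  have := memv_img f eU; rewrite f0 memv0 fE ee => /eqP/matrixP/(_ 0 0)/eqP.
  by rewrite !mxE oner_eq0.
have [M [MM cM]] := IH _ dU'.
have MU y : M *m y \in (U :&: lker f)%VS by rewrite -cM; apply/colspanP; exists y.
have eM : e^T *m M = 0.
  apply/matrixP => i j; have := MU (delta_mx j 0).
  rewrite memv_cap memv_ker fE mulmxA => /andP[_ /eqP/colP/(_ i)].
  by rewrite -(colE j (e^T *m M)) mxE => ->; rewrite !mxE.
have rr : (row_mx e M)^T *m row_mx e M = 1%:M.
  rewrite tr_row_mx mul_col_row ee eM MM.
  have -> : M^T *m e = 0 by rewrite -[M^T *m e]trmxK trmx_mul trmxK eM trmx0.
  by rewrite -scalar_mx_block.
exists (row_mx e M); split; first exact: rr.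
apply/vspaceP => x; apply/idP/idP => [/colspanP[y ->]|xU].
  pose z : 'M[R]_((1 + d)%N, 1) := y.
  have -> : row_mx e M *m y = e *m usubmx z + M *m dsubmx z.
    by rewrite -mul_row_col vsubmxK.
  apply: memvD; first by rewrite [usubmx z]mx11_scalar mul_mx_scalar; exact: memvZ.
  by have := MU (dsubmx z); rewrite memv_cap => /andP[].
have : x - e *m (e^T *m x) \in colspan M.
  rewrite cM memv_cap; apply/andP; split.
    by rewrite memvB // [e^T *m x]mx11_scalar mul_mx_scalar; exact: memvZ.
  by rewrite memv_ker fE mulmxBr (mulmxA e^T e) ee mul1mx subrr.
case/colspanP => y yE; apply/colspanP; exists (col_mx (e^T *m x) y).
have -> : row_mx e M *m col_mx (e^T *m x) y = e *m (e^T *m x) + M *m y.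
  exact: mul_row_col.
by rewrite -yE addrC subrK.
Qed.

Lemma gr_projE (R : realType) (n d : nat) (U : Gr R n d) (M : 'M[R]_(n, d)) :
  orthonormal_rep M U -> gr_proj U = M *m M^T.
Proof.
move=> [MM cM]; rewrite /gr_proj; case: xgetP => [N _ [NN cN]|noM]; last first.
  by have [N NU] := orthonormal_rep_exists U; case: (noM N).
have {cM cN} sub j : exists y, col j N = M *m y.
  apply/colspanP; rewrite cM -cN; apply/colspanP; exists (delta_mx j 0).
  exact: colE.
have NE : N = M *m (M^T *m N).
  apply/matrixP => i j; have [y yE] := sub j.
  have: col j N = M *m (M^T *m col j N) by rewrite yE !mulmxA -(mulmxA M) MM mulmx1.
  move=> /colP/(_ i); rewrite [LHS]mxE => ->.
  by rewrite !colE mulmxA mulmxA -colE mxE mulmxA.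
move: (M^T *m N) NE => B NE.
have BB : B^T *m B = 1%:M.
  by move: NN; rewrite NE trmx_mul mulmxA -(mulmxA B^T) MM mulmx1.
by rewrite NE trmx_mul mulmxA -(mulmxA M) (mulmx1C BB) mulmx1.
Qed.

Definition d2 (R : realType) (n d : nat) (U V : Gr R n d) : R :=
  Num.sqrt (\tr (gr_proj_perp U *m gr_proj V)).

Definition gr_ball (R : realType) (n d : nat) (r : R) (U : Gr R n d) :
    set (Gr R n d) :=
  [set V | d2 U V <= r]%classic.

(* Columns u_{t-T+1}, ..., u_t; only meaningful for [T <= t]. *)
Definition window (R : realType) (n : nat) (u : nat -> 'cV[R]_n) (T t : nat) :
    'M[R]_(n, T) :=
  \matrix_(i < n, j < T) u (t - T + j).+1 i 0.

Definition delta_noise (R : realType) (n : nat) (u : nat -> 'cV[R]_n)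
    (T : nat) (c eps : R) (t : nat) : R :=
  let D : 'M[R]_T := diag_mx (\row_(j < T) (T.-1 - j)%:R) in
  c * frob (window u T t *m D) +
  eps * Num.sqrt T%:R * (c * (T.-1)%:R + 1).

Definition delta_noise_sup (R : realType) (n : nat) (u : nat -> 'cV[R]_n)
    (T : nat) (c eps : R) : R :=
  sup [set `|delta_noise u T c eps t| | t in [set t | (T <= t)%N]]%classic.

Definition gamma_noise (R : realType) (alpha sigmax r s : R) : R :=
  8 * alpha * r * sigmax * (1 + 4 * alpha * sigmax ^+ 2) * s
  + (4 * alpha * r + 16 * alpha ^+ 2 * sigmax ^+ 2 * (r + 2)) * s ^+ 2
  + 32 * alpha ^+ 2 * sigmax * s ^+ 3
  + 8 * alpha ^+ 2 * s ^+ 4.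

Definition contraction_rate (R : realType) (alpha sigmin sigmax r : R) : R :=
  1 - 4 * (1 - r ^+ 2)
      * (alpha * sigmin ^+ 2 - 2 * alpha ^+ 2 * sigmax ^+ 4).

Definition compact_svd (R : realType) (n d : nat) (V Q1 : 'M[R]_(n, d))
    (s : 'rV[R]_d) (Q2 : 'M[R]_d) : Prop :=
  [/\ Q1^T *m Q1 = 1%:M, Q2^T *m Q2 = 1%:M, forall i, 0 <= s 0 i
    & V = Q1 *m diag_mx s *m Q2^T].

(* Graph of the exponential map: [H] is Exp_G(V), where [M] represents [G] and
   [V] is the matrix of the tangent vector with respect to [M].  The result
   does not depend on the choice of the singular value decomposition. *)
Definition is_Exp (R : realType) (n d : nat) (M V : 'M[R]_(n, d))
    (H : Gr R n d) : Prop :=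
  M^T *m V = 0 /\
  exists Q1 s Q2, compact_svd V Q1 s Q2 /\
    colspan (M *m Q2 *m diag_mx (map_mx cos s) *m Q2^T
             + Q1 *m diag_mx (map_mx sin s) *m Q2^T) = val H.

(* Representation, with respect to [M], of the Riemannian gradient at [G] of
   the cost [G |-> frob (gr_proj_perp G *m W) ^+ 2]. *)
Definition grad_cost (R : realType) (n d T : nat) (W : 'M[R]_(n, T))
    (G : Gr R n d) (M : 'M[R]_(n, d)) : 'M[R]_(n, d) :=
  - 2 *: (gr_proj_perp G *m W *m W^T *m M).

Definition gradient_step (R : realType) (n d T : nat) (alpha : R)
    (W : 'M[R]_(n, T)) (G H : Gr R n d) : Prop :=
  exists2 M, orthonormal_rep M G & is_Exp M (- alpha *: grad_cost W G M) H.

Definition GREAT_output (R : realType) (n d : nat) (u : nat -> 'cV[R]_n)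
    (T K : nat) (alpha : R) (t0 : nat) (Uhat : nat -> Gr R n d) : Prop :=
  forall t, (t0 < t)%N ->
    exists G : nat -> Gr R n d,
      [/\ G 0 = Uhat t.-1,
          forall k, (k < K)%N ->
            gradient_step alpha (window u T t) (G k) (G k.+1)
        & Uhat t = G K].

(* Main.v *)
(* With P the projector on the current subspace and P' = 1 - P, the squared
   chordal distance of the span of an orthonormal G is the squared Frobenius
   norm of P'G.  One step moves G along a geodesic with velocity V, and as long
   as the rotation angles are at most 1 a Taylor estimate column by column gives
   |P'G+|^2 <= |P'G|^2 + 2 <P'G, P'V> + 2 |P'V|^2.
   For exact samples, both <P'G, P'V> and |P'V|^2 are controlled by the same
   quantity q = sum_i sin^2(t_i) cos^2(t_i) over the principal angles t_i
   between the two subspaces, and q >= (1 - r^2) |P'G|^2 when the distance is at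
   most r < 1; this yields the rate rho.  The noise contributions add up exactly
   to gamma_r.  The noise assumption keeps the angles at most 1 and the iterates
   in the ball of radius r_b, so that the one-step estimate can be iterated, the
   drift of the target adding at most (2 r_b - c) c to the squared distance
   between two consecutive samples. *)
Require Import Defs.
From mathcomp Require Import all_boot all_order all_algebra.
From mathcomp Require Import all_classical all_reals all_analysis.
From mathcomp Require Import polyrcf complex ring lra zify.
Import Order.TTheory GRing.Theory Num.Theory.
Import numFieldNormedType.Exports.
Local Open Scope ring_scope.

Set Implicit Arguments.
Unset Strict Implicit.
Unset Printing Implicit Defensive.

(** * Frobenius norm *)

Section Frobenius.
Variable R : realType.
Implicit Types m n p q : nat.

Lemma trmxZ m n (a : R) (A : 'M[R]_(m, n)) : (a *: A)^T = a *: A^T.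
Proof. exact: linearZ. Qed.

Lemma mxtrace_tr_mulE m n (A B : 'M[R]_(m, n)) :
  \tr (A^T *m B) = \sum_i \sum_j A i j * B i j.
Proof.
rewrite exchange_big /mxtrace; apply: eq_bigr => j _; rewrite mxE.
by apply: eq_bigr => i _; rewrite mxE.
Qed.

Lemma frob_sqr m n (A : 'M[R]_(m, n)) : frob A ^+ 2 = \tr (A^T *m A).
Proof.
rewrite mxtrace_tr_mulE sqr_sqrtr; last first.
  by apply: sumr_ge0 => i _; apply: sumr_ge0 => j _; exact: sqr_ge0.
by apply: eq_bigr => i _; apply: eq_bigr => j _; rewrite expr2.
Qed.

Lemma frob_ge0 m n (A : 'M[R]_(m, n)) : 0 <= frob A.
Proof. exact: sqrtr_ge0. Qed.
Hint Resolve frob_ge0 : core.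

Lemma frob_le m n p q (A : 'M[R]_(m, n)) (B : 'M[R]_(p, q)) :
  frob A ^+ 2 <= frob B ^+ 2 -> frob A <= frob B.
Proof. by rewrite ler_sqr ?nnegrE. Qed.

Lemma frobT m n (A : 'M[R]_(m, n)) : frob A^T = frob A.
Proof.
rewrite /frob exchange_big; congr Num.sqrt.
by apply: eq_bigr => i _; apply: eq_bigr => j _; rewrite mxE.
Qed.

Lemma frobZ m n (a : R) (A : 'M[R]_(m, n)) : frob (a *: A) = `|a| * frob A.
Proof.
apply/eqP; rewrite -(eqrXn2 (n := 2)) ?mulr_ge0 //.
rewrite exprMn !frob_sqr real_normK ?num_real //.
rewrite trmxZ.
by rewrite -scalemxAl -scalemxAr !mxtraceZ mulrA expr2.
Qed.

Lemma frobN m n (A : 'M[R]_(m, n)) : frob (- A) = frob A.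
Proof. by rewrite -scaleN1r frobZ normrN1 mul1r. Qed.

Lemma frob_sqrD m n (A B : 'M[R]_(m, n)) :
  frob (A + B) ^+ 2 = frob A ^+ 2 + 2 * \tr (A^T *m B) + frob B ^+ 2.
Proof.
rewrite !frob_sqr (_ : (A + B)^T = A^T + B^T); last exact: linearD.
rewrite mulmxDl !mulmxDr !linearD /= -[B^T *m A]trmxK mxtrace_tr trmx_mul trmxK.
by ring.
Qed.

Lemma frob_eq0 m n (A : 'M[R]_(m, n)) : frob A = 0 -> A = 0.
Proof.
move=> A0; have := frob_sqr A; rewrite A0 expr0n /= mxtrace_tr_mulE.
move/esym/psumr_eq0P => H; apply/matrixP => i j; rewrite mxE.
have /psumr_eq0P H' : \sum_j A i j * A i j = 0.
  by apply: H => // k _; apply: sumr_ge0 => l _; rewrite -expr2 sqr_ge0.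
by apply/eqP; rewrite -sqrf_eq0 expr2 H' // => k _; rewrite -expr2 sqr_ge0.
Qed.

(** Expand the squared norm of [frob B *: A - frob A *: B], which is nonnegative. *)
Lemma frob_CauchySchwarz m n (A B : 'M[R]_(m, n)) :
  \tr (A^T *m B) <= frob A * frob B.
Proof.
have [A0|A0] := eqVneq (frob A) 0.
  by rewrite A0 mul0r (frob_eq0 A0) trmx0 mul0mx mxtrace0.
have [B0|B0] := eqVneq (frob B) 0.
  by rewrite B0 mulr0 (frob_eq0 B0) mulmx0 mxtrace0.
have Ap : 0 < frob A by rewrite lt0r A0 /=.
have Bp : 0 < frob B by rewrite lt0r B0 /=.
have := sqr_ge0 (frob (frob B *: A - frob A *: B)).
rewrite frob_sqrD frobN !frobZ !ger0_norm //.
rewrite trmxZ.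
rewrite mulmxN -scalemxAl -scalemxAr linearN /= !mxtraceZ !exprMn => H.
have: 0 <= 2 * (frob A * frob B) * (frob A * frob B - \tr (A^T *m B)).
  apply: le_trans H _; by rewrite le_eqVlt; apply/orP; left; apply/eqP; ring.
by rewrite pmulr_rge0 ?subr_ge0 // mulr_gt0 // mulr_gt0.
Qed.

Lemma frobD m n (A B : 'M[R]_(m, n)) : frob (A + B) <= frob A + frob B.
Proof.
rewrite -ler_sqr ?nnegrE ?addr_ge0 // frob_sqrD sqrrD.
have := frob_CauchySchwarz A B; lra.
Qed.

Lemma frob_sqr_col m n (A : 'M[R]_(m, n)) :
  frob A ^+ 2 = \sum_j frob (col j A) ^+ 2.
Proof.
rewrite frob_sqr mxtrace_tr_mulE exchange_big; apply: eq_bigr => j _.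
rewrite frob_sqr mxtrace_tr_mulE; apply: eq_bigr => i _.
by rewrite big_ord1 !mxE.
Qed.

Lemma frob_col_le m n (A : 'M[R]_(m, n)) j : frob (col j A) <= frob A.
Proof.
apply: frob_le; rewrite (frob_sqr_col A) (bigD1 j) //= lerDl.
by apply: sumr_ge0 => k _; exact: sqr_ge0.
Qed.

Lemma frob_mulmx_le m n p q (k : R) (A : 'M[R]_(m, n)) (C : 'M[R]_(p, n))
    (B : 'M[R]_(n, q)) : 0 <= k ->
  (forall y : 'cV_n, frob (A *m y) <= k * frob (C *m y)) ->
  frob (A *m B) <= k * frob (C *m B).
Proof.
move=> k0 le_AC; rewrite -ler_sqr ?nnegrE ?mulr_ge0 // exprMn !frob_sqr_col.
rewrite mulr_sumr; apply: ler_sum => j _; rewrite -exprMn.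
by rewrite ler_sqr ?nnegrE ?mulr_ge0 // !colE -!mulmxA -!colE.
Qed.

Lemma frob_mulmx_ge m n p q (k : R) (A : 'M[R]_(m, n)) (C : 'M[R]_(p, n))
    (B : 'M[R]_(n, q)) : 0 <= k ->
  (forall y : 'cV_n, k * frob (A *m y) <= frob (C *m y)) ->
  k * frob (A *m B) <= frob (C *m B).
Proof.
move=> k0 le_AC; rewrite -{1}(ger0_norm k0) -frobZ scalemxAl -[leRHS]mul1r.
apply: frob_mulmx_le => // y; rewrite -scalemxAl frobZ ger0_norm // mul1r.
exact: le_AC.
Qed.

Lemma frob_mulmx m n p (A : 'M[R]_(m, n)) (B : 'M[R]_(n, p)) :
  frob (A *m B) <= frob A * frob B.
Proof.
rewrite -[B in X in _ <= X]mul1mx; apply: frob_mulmx_le => // y.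
rewrite mul1mx -ler_sqr ?nnegrE ?mulr_ge0 // exprMn.
rewrite -(frobT A) (frob_sqr_col A^T) mulr_suml frob_sqr mxtrace_tr_mulE.
apply: ler_sum => i _; rewrite big_ord1 -expr2 -exprMn.
rewrite -ler_sqrt ?sqr_ge0 // !sqrtr_sqr [X in _ <= X]ger0_norm ?mulr_ge0 //.
have E : (A *m y) i 0 = \tr ((col i A^T)^T *m y).
  by rewrite mxtrace_tr_mulE mxE; apply: eq_bigr => k _; rewrite big_ord1 !mxE.
rewrite ler_norml E frob_CauchySchwarz andbT lerNl.
by rewrite -linearN -mulmxN -[X in _ * X]frobN frob_CauchySchwarz.
Qed.

Lemma frob_mulmx_row m n p (A : 'M[R]_(m, n)) (Q : 'M[R]_(n, p)) :
  Q *m Q^T = 1%:M -> frob (A *m Q) = frob A.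
Proof.
move=> QQ; apply/eqP; rewrite -(eqrXn2 (n := 2)) // !frob_sqr.
by rewrite mxtrace_mulC trmx_mul -mulmxA (mulmxA Q) QQ mul1mx mxtrace_mulC.
Qed.

(** Bounds the spectral norm by [k] without forming a supremum. *)
Definition op_le m n (k : R) (A : 'M[R]_(m, n)) : Prop :=
  forall y : 'cV_n, frob (A *m y) <= k * frob y.

Lemma op_le_mulmx m n p (k : R) (A : 'M[R]_(m, n)) (B : 'M[R]_(n, p)) :
  0 <= k -> op_le k A -> frob (A *m B) <= k * frob B.
Proof.
move=> k0 kA; rewrite -[B in X in _ <= X]mul1mx.
by apply: frob_mulmx_le => // y; rewrite mul1mx.
Qed.

(** The square of |A^T y| is the inner product of y with A A^T y, at most |y| k |A^T y|; one factor
    cancels. *)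
Lemma op_leT m n (k : R) (A : 'M[R]_(m, n)) :
  0 <= k -> op_le k A -> op_le k A^T.
Proof.
move=> k0 kA y; have [->|A0] := eqVneq (frob (A^T *m y)) 0.
  by rewrite mulr_ge0.
have Ap : 0 < frob (A^T *m y) by rewrite lt0r A0 /=.
rewrite -(ler_pM2r Ap) -expr2 frob_sqr trmx_mul trmxK -mulmxA.
apply: le_trans (frob_CauchySchwarz _ _) _.
by rewrite mulrAC mulrC ler_wpM2r.
Qed.

Lemma op_le_mulmxr m n p (k : R) (A : 'M[R]_(m, n)) (B : 'M[R]_(p, m)) :
  0 <= k -> op_le k A -> frob (B *m A) <= k * frob B.
Proof.
by move=> k0 kA; rewrite -frobT trmx_mul -[frob B]frobT op_le_mulmx //; apply: op_leT.
Qed.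

Definition orthoproj n (P : 'M[R]_n) : Prop := P^T = P /\ P *m P = P.

Lemma orthoproj_compl n (P : 'M[R]_n) : orthoproj P -> orthoproj (1%:M - P).
Proof.
move=> [PT PP]; split; first by rewrite linearB /= trmx1 PT.
by rewrite mulmxBr mulmx1 mulmxBl mul1mx PP subrr subr0.
Qed.

Lemma orthoproj_gram n d (G : 'M[R]_(n, d)) :
  G^T *m G = 1%:M -> orthoproj (G *m G^T).
Proof.
move=> GG; split; first by rewrite trmx_mul trmxK.
by rewrite mulmxA -(mulmxA G) GG mulmx1.
Qed.

Lemma orthoproj_pythagoras n m (P : 'M[R]_n) (B : 'M[R]_(n, m)) : orthoproj P ->
  frob B ^+ 2 = frob (P *m B) ^+ 2 + frob ((1%:M - P) *m B) ^+ 2.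
Proof.
move=> [PT PP]; rewrite -{1}[B](_ : P *m B + (1%:M - P) *m B = _); last first.
  by rewrite -mulmxDl addrC subrK mul1mx.
rewrite frob_sqrD trmx_mul PT -mulmxA (mulmxA P) mulmxBr mulmx1 PP subrr.
by rewrite mul0mx mulmx0 mxtrace0 mulr0 addr0.
Qed.

Lemma orthoproj_op_le n (P : 'M[R]_n) : orthoproj P -> op_le 1 P.
Proof.
move=> oP y; rewrite mul1r; apply: frob_le.
by rewrite (orthoproj_pythagoras y oP) lerDl sqr_ge0.
Qed.

Lemma isometry_frob n d m (G : 'M[R]_(n, d)) (B : 'M[R]_(d, m)) :
  G^T *m G = 1%:M -> frob (G *m B) = frob B.
Proof.
move=> GG; apply/eqP; rewrite -(eqrXn2 (n := 2)) // !frob_sqr trmx_mul.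
by rewrite -mulmxA (mulmxA G^T) GG mul1mx.
Qed.

End Frobenius.
#[export] Hint Extern 0 (is_true (0 <= frob _)) => solve [exact: frob_ge0] : core.

(** * Geodesics of the Grassmannian *)

Section Trigonometry.
Variable R : realType.
Implicit Types s x : R.

Lemma is_derive_ge0_le (f df : R -> R) x : 0 <= x ->
  (forall y : R, is_derive y 1 f (df y)) -> (forall y, 0 <= y -> 0 <= df y) ->
  f 0 <= f x.
Proof.
move=> x0 fdf df0.
have fc : {within `[0, x], continuous f}%classic.
  apply: derivable_within_continuous => y _.
  exact: (@ex_derive _ _ _ _ _ _ _ (fdf y)).
have [c c0x E] := MVT_segment x0 (fun y _ => fdf y) fc.
rewrite -subr_ge0 E subr0 mulr_ge0 // df0 //.
by move: c0x; rewrite in_itv => /andP[].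
Qed.

Lemma sin_le_id x : 0 <= x -> sin x <= x.
Proof.
move=> x0; rewrite -subr_ge0.
apply: le_trans (is_derive_ge0_le (f := fun y => y - sin y)
  (df := fun y => 1 - cos y) x0 _ _); first by rewrite sin0 subr0.
by move=> y y0; rewrite subr_ge0 cos_le1.
Qed.

(** The derivative of the gap is the gap of [sin_le_id], so monotonicity from 0 suffices;
    [sin_ge_cubic] repeats this one order higher. *)
Lemma cos_ge_quadratic x : 0 <= x -> 1 - x ^+ 2 / 2 <= cos x.
Proof.
move=> x0; have := is_derive_ge0_le (f := fun y => cos y - 1 + y ^+ 2 / 2)
  (df := fun y => y - sin y) x0.
rewrite cos0 expr0n /= mul0r subrr addr0 => H.
rewrite -subr_ge0; apply: le_trans (H _ _) _.
- by move=> y; apply: is_derive_eq; rewrite /GRing.scale /=; field.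
- by move=> y y0; rewrite subr_ge0 sin_le_id.
- by rewrite le_eqVlt; apply/orP; left; apply/eqP; ring.
Qed.

Lemma sin_ge_cubic x : 0 <= x -> x - x ^+ 3 / 6 <= sin x.
Proof.
move=> x0; have := is_derive_ge0_le (f := fun y => sin y - y + y ^+ 3 / 6)
  (df := fun y => cos y - 1 + y ^+ 2 / 2) x0.
rewrite sin0 expr0n /= mul0r subrr addr0 => H.
rewrite -subr_ge0; apply: le_trans (H _ _) _.
- by move=> y; apply: is_derive_eq; rewrite /GRing.scale /=; field.
- by move=> y y0; have := cos_ge_quadratic y0; lra.
- by rewrite le_eqVlt; apply/orP; left; apply/eqP; ring.
Qed.

(** One column of the geodesic: [a] and [b] are the norms of its position and direction, [c] their
    inner product, [s] the rotation angle. The error s - cos s sin s in the cross term is cubic,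
    hence absorbed by the two square terms when s is at most 1. *)
Lemma geodesic_scalar_bound s (a b c : R) : 0 <= s <= 1 -> 0 <= a -> 0 <= b ->
  `|c| <= a * b ->
  cos s ^+ 2 * a ^+ 2 + 2 * (cos s * sin s * c) + sin s ^+ 2 * b ^+ 2 <=
  a ^+ 2 + 2 * (s * c) + 2 * (s ^+ 2 * b ^+ 2).
Proof.
move=> /andP[s0 s1] a0 b0 cab.
have s20 : 0 <= s *+ 2 by rewrite mulrn_wge0.
have := sin_ge_cubic s0; have := sin_ge_cubic s20.
rewrite sin_mulr2n !mulr2n => h2 h1.
have h3 := sin_le_id s0; have h4 := cos_le1 s.
rewrite cos2sin2; move: (sin s) (cos s) h1 h2 h3 h4 => S C h1 h2 h3 h4.
have S56 : 5 / 6 * s <= S.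
  have : s * s ^+ 2 <= s * 1 by rewrite ler_wpM2l // expr_le1.
  by rewrite -exprS; lra.
(* The cubic bound on sin at 2s gives k <= (2/3) s^3. *)
pose k := s - C * S; have -> : C * S = s - k by rewrite /k; ring.
have k_le : k <= 2 / 3 * s ^+ 3 by rewrite /k; lra.
have k_ge0 : 0 <= k.
  rewrite /k subr_ge0; apply: le_trans h3; rewrite ler_piMl //; lra.
suff : - (2 * k * c) <= S ^+ 2 * a ^+ 2 + (2 * s ^+ 2 - S ^+ 2) * b ^+ 2 by lra.
have s2ab : 0 <= s ^+ 2 * (a * b) by rewrite mulr_ge0 ?sqr_ge0 ?mulr_ge0.
apply: (@le_trans _ _ (4 / 3 * (s ^+ 2 * (a * b)))).
  have ab0 : 0 <= a * b by exact: mulr_ge0.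
  have : k * - c <= 2 / 3 * s ^+ 3 * (a * b).
    apply: le_trans (ler_norm _) _; rewrite normrM normrN (ger0_norm k_ge0).
    exact: ler_pM.
  have : s * (s ^+ 2 * (a * b)) <= 1 * (s ^+ 2 * (a * b)) by rewrite ler_wpM2r.
  lra.
have S2 : 25 / 36 * s ^+ 2 <= S ^+ 2.
  have : (5 / 6 * s) ^+ 2 <= S ^+ 2 by rewrite ler_sqr ?nnegrE //; lra.
  by rewrite exprMn; lra.
have S2' : S ^+ 2 <= s ^+ 2 by rewrite ler_sqr ?nnegrE //; lra.
apply: (@le_trans _ _ (25 / 36 * s ^+ 2 * a ^+ 2 + s ^+ 2 * b ^+ 2)); last first.
  by apply: lerD; rewrite ler_wpM2r ?sqr_ge0 //; lra.
(* This square gives 25/36 a^2 + b^2 >= 5/3 a b, more than the 4/3 a b required. *)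
have := mulr_ge0 (sqr_ge0 s) (sqr_ge0 (5 / 6 * a - b)).
lra.
Qed.

End Trigonometry.

Section Geodesic.
Variable R : realType.
Implicit Types n d : nat.

Lemma mxtrace_tr_mul_col n d (A B : 'M[R]_(n, d)) :
  \tr (A^T *m B) = \sum_j \tr ((col j A)^T *m col j B).
Proof.
rewrite mxtrace_tr_mulE exchange_big; apply: eq_bigr => j _.
by rewrite mxtrace_tr_mulE; apply: eq_bigr => i _; rewrite big_ord1 !mxE.
Qed.

Lemma col_mul_diag n d (A : 'M[R]_(n, d)) (s : 'rV_d) j :
  col j (A *m diag_mx s) = s 0 j *: col j A.
Proof. by apply/colP => i; rewrite mul_mx_diag !mxE mulrC. Qed.

(* Second order Taylor bound along a geodesic; [s <= 1] is what makes the
   constant 2 in front of the quadratic term possible. *)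
Lemma geodesic_bound n d (A B : 'M[R]_(n, d)) (s : 'rV[R]_d) :
  (forall j, 0 <= s 0 j <= 1) ->
  frob (A *m diag_mx (map_mx cos s) + B *m diag_mx (map_mx sin s)) ^+ 2 <=
  frob A ^+ 2 + 2 * \tr (A^T *m (B *m diag_mx s))
    + 2 * frob (B *m diag_mx s) ^+ 2.
Proof.
move=> s01; rewrite !frob_sqr_col mxtrace_tr_mul_col !mulr_sumr -!big_split /=.
apply: ler_sum => j _; rewrite linearD /= !col_mul_diag !mxE frob_sqrD.
rewrite !frobZ !exprMn !real_normK ?num_real //.
rewrite trmxZ -scalemxAl -!scalemxAr !mxtraceZ mulrA.
rewrite -[cos (s 0 j) * _ * _]mulrA.
have := geodesic_scalar_bound (c := \tr ((col j A)^T *m col j B)) (s01 j)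
  (frob_ge0 (col j A)) (frob_ge0 (col j B)).
rewrite !mulrA; apply.
rewrite ler_norml frob_CauchySchwarz andbT lerNl -linearN -mulmxN.
by rewrite -[X in _ * X]frobN frob_CauchySchwarz.
Qed.

End Geodesic.

(** * Singular values *)

Section SymmetricSpectral.
Variable R : realType.
Implicit Types n m d T : nat.

(** Over the complex numbers [A] is hermitian, so it diagonalises with a real diagonal; a real root
    of the complexified characteristic polynomial is a root of the original one. *)
Lemma symmetric_eigenvalue n (A : 'M[R]_n.+1) : A^T = A ->
  exists a, eigenvalue A a.
Proof.
move=> AT; pose AC := map_mx (real_complex R) A.
have ACsym : AC \is hermsymmx.
  apply: realsym_hermsym.
    apply/is_hermitianmxP; rewrite expr0 scale1r map_mx_id //.
    by apply/matrixP => i j; rewrite !mxE -[in LHS]AT mxE.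
  apply/mxOverP => i j; rewrite mxE.
  by apply/complex_realP; exists (A i j).
have /hermitian_normalmx/orthomx_spectralP := ACsym.
have Dreal := hermitian_spectral_diag_real ACsym.
set P := spectralmx AC; set D := spectral_diag AC in Dreal *; move=> ACE.
have Pu : P \in unitmx by exact: spectral_unit.
have PAC : P *m AC = diag_mx D *m P by rewrite {1}ACE -!mulmxA mulKVmx.
have eD : eigenvalue AC (D 0 0).
  apply/eigenvalueP; exists (row 0 P).
    by rewrite -row_mul PAC row_mul row_diag_mx -scalemxAl -rowE.
  (* A zero row would make the determinant of the invertible [P] vanish. *)
  apply: contraTneq Pu => P0; rewrite unitmxE (expand_det_row P 0).
  rewrite big1 ?unitr0 // => j _; have /rowP/(_ j) := P0.
  by rewrite !mxE => ->; rewrite mul0r.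
exists (complex.Re (D 0 0)); rewrite eigenvalue_root_char.
rewrite -(fmorph_root (real_complex R)) map_char_poly /=.
rewrite -eigenvalue_root_char -/AC.
have -> // : real_complex_def (Phant R) (complex.Re (D 0 0)) = D 0 0.
by rewrite RRe_real // (mxOverP Dreal).
Qed.

(** The kernel of x -> e^T x has dimension [n]; viewed as a point of the Grassmannian it has an
    orthonormal representative. *)
Lemma orthonormal_complement n (e : 'cV[R]_n.+1) : e^T *m e = 1%:M ->
  exists M : 'M[R]_(n.+1, n), M^T *m M = 1%:M /\ e^T *m M = 0.
Proof.
move=> ee; pose f : 'Hom('cV[R]_n.+1, 'cV[R]_1) := linfun (mulmx e^T).
have fE x : f x = e^T *m x by rewrite lfunE.
have dker : \dim (lker f) == n.
  have := limg_ker_dim f fullv; rewrite capfv dimvf /dim /= muln1.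
  suff -> : \dim (f @: fullv) = 1%N by rewrite addn1 => -[->].
  apply/eqP; rewrite eqn_leq; apply/andP; split.
    by rewrite (leq_trans (dimvS (subvf _))) // dimvf.
  rewrite lt0n dimv_eq0; apply/negP => /eqP f0.
  have := memv_img f (memvf e); rewrite f0 memv0 fE ee => /eqP/matrixP/(_ 0 0)/eqP.
  by rewrite !mxE oner_eq0.
have [M [MM cM]] := orthonormal_rep_exists (exist _ (lker f) dker : Gr R n.+1 n).
exists M; split => //.
apply/matrixP => i j; have : M *m delta_mx j 0 \in lker f.
  by rewrite -[lker f]cM; apply/colspanP; exists (delta_mx j 0).
rewrite memv_ker fE mulmxA => /eqP/colP/(_ i).
by rewrite -(colE j (e^T *m M)) mxE => ->; rewrite !mxE.
Qed.

(** Deflation: split off a unit eigenvector [e] and apply induction to the compression of [A] to its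
    orthogonal complement. *)
Theorem symmetric_spectral n (A : 'M[R]_n) : A^T = A ->
  exists (V : 'M[R]_n) (l : 'rV[R]_n),
    V^T *m V = 1%:M /\ A = V *m diag_mx l *m V^T.
Proof.
elim: n A => [|n IH] A AT.
  by exists 1%:M, 0; split; apply/matrixP => -[].
have [a /eigenvalueP[v vA v0]] := symmetric_eigenvalue AT.
have v0' : frob v != 0 by apply: contra_neq v0; exact: frob_eq0.
pose e := (frob v)^-1 *: v^T.
have eT : e^T = (frob v)^-1 *: v by rewrite /e trmxZ trmxK.
have ee : e^T *m e = 1%:M.
  rewrite [LHS]mx11_scalar -trace_mx11 -frob_sqr /e frobZ frobT.
  by rewrite ger0_norm ?invr_ge0 ?frob_ge0 // mulVf // expr1n.
have eA : e^T *m A = a *: e^T by rewrite eT -scalemxAl vA !scalerA mulrC.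
have Ae : A *m e = a *: e.
  have := congr1 trmx eA; rewrite trmx_mul trmxK AT => ->.
  by rewrite trmxZ trmxK.
have [M [MM eM]] := orthonormal_complement ee.
have Me : M^T *m e = 0 by rewrite -[LHS]trmxK trmx_mul trmxK eM trmx0.
have [V [l [VV A'E]]] : exists (V : 'M[R]_n) (l : 'rV[R]_n),
    V^T *m V = 1%:M /\ M^T *m A *m M = V *m diag_mx l *m V^T.
  by apply: IH; rewrite !trmx_mul trmxK AT mulmxA.
pose Q : 'M[R]_(n.+1, 1 + n) := row_mx e (M *m V).
have QQ : Q^T *m Q = 1%:M.
  rewrite tr_row_mx mul_col_row ee mulmxA eM mul0mx trmx_mul -mulmxA Me mulmx0.
  by rewrite -mulmxA (mulmxA M^T) MM mul1mx VV -scalar_mx_block.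
have QQ' : Q *m Q^T = 1%:M by exact: mulmx1C.
(* The complement is invariant: e^T A M = a e^T M = 0, and e e^T + M M^T is the identity. *)
have AM : A *m M = M *m (M^T *m A *m M).
  have E : e *m e^T + M *m M^T = 1%:M.
    pose B : 'M[R]_(n.+1, 1 + n) := row_mx e M.
    have BB : B^T *m B = 1%:M.
      by rewrite tr_row_mx mul_col_row ee eM MM Me -scalar_mx_block.
    by rewrite -(mulmx1C BB) tr_row_mx mul_row_col.
  rewrite -[LHS]mul1mx -E mulmxDl !mulmxA -[e *m e^T *m A]mulmxA eA.
  by rewrite -scalemxAr -scalemxAl -(mulmxA e e^T M) eM mulmx0 scaler0 add0r.
pose L : 'rV[R]_(1 + n) := row_mx a%:M l.
have AQ : A *m Q = Q *m diag_mx L.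
  rewrite diag_mx_row mul_mx_row Ae mulmxA AM A'E.
  rewrite -!mulmxA VV mulmx1 mul_row_block !mulmx0 addr0 add0r -mulmxA.
  congr row_mx; rewrite -mul_mx_scalar; congr (_ *m _).
  by apply/matrixP => i j; rewrite !mxE !ord1 !mulr1n.
by exists Q, L; split=> //; rewrite -AQ -mulmxA QQ' mulmx1.
Qed.

End SymmetricSpectral.

(** * Singular values as bounds on the action of a matrix *)

Section SingularValues.
Variable R : realType.
Implicit Types n m d T : nat.

Lemma char_poly_spectral n (V : 'M[R]_n) (l : 'rV[R]_n) : V^T *m V = 1%:M ->
  char_poly (V *m diag_mx l *m V^T) =
    \prod_(x <- [seq l 0 i | i <- enum 'I_n]) ('X - x%:P).
Proof.
move=> VV; have VV' := mulmx1C VV.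
pose VP := map_mx polyC V; pose VTP := map_mx polyC V^T.
have VVP : VP *m VTP = 1%:M by rewrite -map_mxM VV' map_mx1.
rewrite /char_poly /char_poly_mx !map_mxM -/VP -/VTP.
have -> : 'X%:M - VP *m map_mx polyC (diag_mx l) *m VTP =
    VP *m char_poly_mx (diag_mx l) *m VTP.
  rewrite /char_poly_mx mulmxBr mulmxBl; congr (_ - _).
  by rewrite mul_mx_scalar -scalemxAl VVP scale_scalar_mx mulr1.
rewrite !det_mulmx mulrAC -det_mulmx VVP det1 mul1r -/(char_poly _).
rewrite char_poly_trig ?diag_mx_is_trig // big_map big_enum /=.
by apply: eq_bigr => i _; rewrite !mxE eqxx mulr1n.
Qed.

Lemma mup_prod_XsubC (s : seq R) x :
  mup x (\prod_(y <- s) ('X - y%:P)) = count_mem x s.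
Proof.
elim: s => [|y s IH]; first by rewrite big_nil mupNroot // root1.
rewrite big_cons mupM ?polyXsubC_eq0 ?monic_neq0 ?monic_prod_XsubC //=.
by rewrite IH -[X in mup x X]expr1 mup_XsubCX; case: (y == x).
Qed.

Lemma count_flatten_nseq (m : R -> nat) (s : seq R) z : uniq s ->
  count_mem z (flatten [seq nseq (m x) x | x <- s]) = ((z \in s) * m z)%N.
Proof.
elim: s => //= x s IH /andP[xs /IH]; rewrite count_cat count_nseq in_cons => -> /=.
rewrite [z == x]eq_sym; case: eqP => [<-|_] //=.
by rewrite (negPf xs) addn0.
Qed.

Lemma sorted_flatten_nseq (m : R -> nat) (s : seq R) : sorted >%R s ->
  sorted >=%R (flatten [seq nseq (m x) x | x <- s]).
Proof.
have ge_trans : transitive (>=%R : rel R) by exact: rev_trans le_trans.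
have gt_trans : transitive (>%R : rel R) by exact: rev_trans lt_trans.
rewrite !sorted_pairwise //; elim: s => //= x s IH /andP[/allP xs /IH].
rewrite pairwise_cat => ->; rewrite andbT; apply/andP; split.
  apply/allrelP => y z; rewrite mem_nseq => /andP[_ /eqP->].
  move=> /flattenP[_ /mapP[w ws ->]]; rewrite mem_nseq => /andP[_ /eqP->].
  exact/ltW/xs.
elim: (m x) => //= k ->; rewrite andbT; apply/allP => y.
by rewrite mem_nseq => /andP[_ /eqP->] /=.
Qed.

Lemma sorted_gram_eigenvalues m n (A : 'M[R]_(m, n)) :
  sorted >=%R (gram_eigenvalues A).
Proof.
rewrite /gram_eigenvalues; set p := char_poly _.
apply: (@sorted_flatten_nseq (fun x => mup x p)).
by rewrite rev_sorted; exact: sorted_roots.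
Qed.

(** Each number occurs in both lists as often as its multiplicity as a root of the characteristic
    polynomial. Thus the eigenvalue list can be read off any orthogonal diagonalisation. *)
Lemma gram_eigenvalues_spectral m n (A : 'M[R]_(m, n)) (V : 'M[R]_n)
    (l : 'rV[R]_n) : V^T *m V = 1%:M -> A^T *m A = V *m diag_mx l *m V^T ->
  perm_eq (gram_eigenvalues A) [seq l 0 i | i <- enum 'I_n].
Proof.
move=> VV AE; apply/allP => z _ /=; apply/eqP; rewrite /gram_eigenvalues.
set p := char_poly _.
have p0 : p != 0 by rewrite monic_neq0 ?char_poly_monic.
have roots_uniq : uniq (rootsR p).
  by apply: (sorted_uniq lt_trans lt_irreflexive); exact: sorted_roots.
rewrite (@count_flatten_nseq (fun x => mup x p)) ?rev_uniq // mem_rev.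
rewrite -(roots_on_rootsR p0) inE /=.
rewrite -mup_prod_XsubC -(char_poly_spectral l VV) -AE -/p.
by case: (boolP (root p z)) => [|/mupNroot->]; rewrite ?mul1n ?muln0.
Qed.

Lemma sqrtr_le_sqr (x k : R) : Num.sqrt x <= k -> x <= k ^+ 2.
Proof.
move=> xk; have [x0|x0] := leP 0 x; last by rewrite (le_trans (ltW x0)) ?sqr_ge0.
have k0 : 0 <= k by rewrite (le_trans _ xk) ?sqrtr_ge0.
by rewrite -(sqr_sqrtr x0) ler_sqr ?nnegrE ?sqrtr_ge0.
Qed.

Lemma frob_sqr_diag n (l : 'rV[R]_n) (y : 'cV[R]_n) :
  frob (diag_mx l *m y) ^+ 2 = \sum_i l 0 i ^+ 2 * y i 0 ^+ 2.
Proof.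
rewrite frob_sqr mxtrace_tr_mulE; apply: eq_bigr => i _.
by rewrite big_ord1 mul_diag_mx !mxE; ring.
Qed.

Lemma trace_diag_quadratic n (l : 'rV[R]_n) (y : 'cV[R]_n) :
  \tr (y^T *m diag_mx l *m y) = \sum_i l 0 i * y i 0 ^+ 2.
Proof.
rewrite -mulmxA mxtrace_tr_mulE; apply: eq_bigr => i _.
by rewrite big_ord1 mul_diag_mx !mxE; ring.
Qed.

(** The head of the nonincreasing list dominates all eigenvalues, and in the eigenbasis |A y|^2 is
    their sum weighted by squared coordinates. *)
Lemma singular_value1_op_le m n (A : 'M[R]_(m, n)) (k : R) :
  singular_value A 1 <= k -> op_le k A.
Proof.
move=> Ak y; have k0 : 0 <= k by rewrite (le_trans _ Ak) ?sqrtr_ge0.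
have [V [l [VV AE]]] : exists (V : 'M[R]_n) (l : 'rV[R]_n),
    V^T *m V = 1%:M /\ A^T *m A = V *m diag_mx l *m V^T.
  by apply: symmetric_spectral; rewrite trmx_mul trmxK.
have lk i : l 0 i <= k ^+ 2.
  apply: le_trans (sqrtr_le_sqr Ak); rewrite /=.
  have : l 0 i \in gram_eigenvalues A.
    by rewrite (perm_mem (gram_eigenvalues_spectral VV AE)) map_f ?mem_enum.
  case: (gram_eigenvalues A) (sorted_gram_eigenvalues A) => //= x s.
  rewrite (path_sortedE (rev_trans le_trans)) => /andP[/allP xs _].
  by rewrite inE => /orP[/eqP->|/xs].
rewrite -ler_sqr ?nnegrE ?mulr_ge0 // exprMn frob_sqr trmx_mul -mulmxA.
rewrite (mulmxA A^T) AE.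
have -> : y^T *m (V *m diag_mx l *m V^T *m y) =
    (V^T *m y)^T *m diag_mx l *m (V^T *m y) by rewrite trmx_mul trmxK !mulmxA.
have -> : frob y = frob (V^T *m y).
  by rewrite isometry_frob // trmxK; exact: mulmx1C.
rewrite trace_diag_quadratic frob_sqr mxtrace_tr_mulE mulr_sumr.
by apply: ler_sum => i _; rewrite big_ord1 -expr2 ler_wpM2r ?sqr_ge0.
Qed.

Lemma count_ge_nth (s : seq R) (x0 x : R) i : sorted >=%R s -> (i < size s)%N ->
  x <= nth x0 s i -> (i < count (>= x) s)%N.
Proof.
move=> ss si xi; rewrite -[s in count _ s](cat_take_drop i.+1) count_cat.
apply: leq_trans (leq_addr _ _).
have st : size (take i.+1 s) = i.+1 by rewrite size_takel.
have : all (>= x) (take i.+1 s).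
  apply/(all_nthP x0) => j; rewrite st => ji; rewrite nth_take //.
  apply: le_trans xi _.
  by apply: (sorted_leq_nth (rev_trans le_trans) le_refl _ ss); rewrite ?inE //;
     apply: leq_ltn_trans si.
by rewrite all_count => /eqP->; rewrite st.
Qed.

(* The [d] leading right singular vectors [Vf] of [B] are mapped by [B] to an
   orthogonal basis [C] of the whole space, on which [B^T] is explicit. *)
Lemma singular_value_lower n d T (M : 'M[R]_(n, d)) (B : 'M[R]_(d, T)) (k : R) :
  M^T *m M = 1%:M -> 0 < k -> k <= singular_value (M *m B) d ->
  forall y : 'cV_d, k * frob y <= frob (B^T *m y).
Proof.
move=> MM k0 kB y; case: d => [|d] in M B MM kB y *.
  have -> : y = 0 by apply/matrixP => -[].
  have -> : frob (0 : 'cV[R]_0) = 0.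
    by rewrite -(scale0r 0) frobZ normr0 mul0r.
  by rewrite mulr0.
set A := M *m B in kB.
have AA : A^T *m A = B^T *m B by rewrite trmx_mul -mulmxA (mulmxA M^T) MM mul1mx.
have [V [l [VV AE]]] : exists (V : 'M[R]_T) (l : 'rV[R]_T),
    V^T *m V = 1%:M /\ A^T *m A = V *m diag_mx l *m V^T.
  by apply: symmetric_spectral; rewrite trmx_mul trmxK.
(* As [0 < k], neither default value 0 can occur: that of [Num.sqrt] at a negative number, nor, in
   [ds], that of [nth] past the end of the list. *)
have k2 : k ^+ 2 <= (gram_eigenvalues A)`_d.
  have g0 : 0 <= (gram_eigenvalues A)`_d.
    rewrite leNgt; apply/negP => g0; move: kB.
    by rewrite /singular_value /= ltr0_sqrtr // leNgt k0.
  by rewrite -(sqr_sqrtr g0) ler_sqr ?nnegrE ?sqrtr_ge0 ?(ltW k0).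
have ds : (d < size (gram_eigenvalues A))%N.
  rewrite ltnNge; apply/negP => sd; move: k2; rewrite nth_default //.
  by rewrite leNgt exprn_gt0.
pose I := [pred i | k ^+ 2 <= l 0 i].
have dI : (d.+1 <= #|I|)%N.
  have := count_ge_nth (sorted_gram_eigenvalues A) ds k2.
  rewrite (permP (gram_eigenvalues_spectral VV AE)) count_map.
  by rewrite cardE size_filter enumT.
pose f (i : 'I_d.+1) : 'I_T := enum_val (widen_ord dI i).
have f_inj : injective f.
  by move=> i j /enum_val_inj/(congr1 val)/= ij; exact: val_inj.
have lf i : k ^+ 2 <= l 0 (f i) by exact: enum_valP (widen_ord dI i).
pose L : 'rV[R]_d.+1 := \row_i l 0 (f i).
pose Vf := colsub f V.
have VfE : Vf = V *m colsub f 1%:M by rewrite mulmx_colsub mulmx1.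
have VfVf : Vf^T *m Vf = 1%:M.
  apply/matrixP => i j; have /matrixP/(_ (f i) (f j)) := VV.
  rewrite !mxE (inj_eq f_inj) => <-; apply: eq_bigr => h _; rewrite !mxE.
  by [].
have BVf : B^T *m (B *m Vf) = Vf *m diag_mx L.
  rewrite mulmxA -AA AE VfE -[LHS]mulmxA (mulmxA V^T) VV mul1mx -!mulmxA.
  congr (_ *m _); apply/matrixP => i j.
  rewrite mul_diag_mx mul_mx_diag !mxE.
  by have [->|_] := eqVneq i (f j); rewrite ?mulr1 ?mul1r ?mulr0 ?mul0r.
pose C := B *m Vf.
have CC : C^T *m C = diag_mx L.
  by rewrite trmx_mul -mulmxA BVf mulmxA VfVf mul1mx.
have Cu : C \in unitmx.
  have : C^T *m C \in unitmx.
    rewrite CC unitmxE det_diag unitfE; apply/prodf_neq0 => i _.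
    by rewrite mxE gt_eqF // (lt_le_trans _ (lf i)) ?exprn_gt0.
  by rewrite unitmx_mul => /andP[].
(* In the coordinates z, |y|^2 is the sum of l z^2 and |B^T y|^2 that of l^2 z^2, with every l at
   least k^2. *)
have -> : y = C *m (invmx C *m y) by rewrite mulKVmx.
move: (invmx C *m y) => {y} z.
rewrite -ler_sqr ?nnegrE ?mulr_ge0 ?(ltW k0) // exprMn [B^T *m _]mulmxA BVf.
rewrite -[Vf *m _ *m z]mulmxA (isometry_frob _ VfVf) frob_sqr_diag.
rewrite frob_sqr trmx_mul -mulmxA.
rewrite (mulmxA C^T) CC mulmxA trace_diag_quadratic mulr_sumr.
apply: ler_sum => i _; rewrite mulrA ler_wpM2r ?sqr_ge0 // expr2.
have := lf i; rewrite mxE => li; rewrite ler_wpM2r //.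
by rewrite (le_trans _ li) ?sqr_ge0.
Qed.

End SingularValues.

(** * One gradient step *)

Section Chordal.
Variable R : realType.
Implicit Types n d : nat.

Lemma orthoproj_gr_proj n d (U : Gr R n d) : orthoproj (gr_proj U).
Proof.
have [M MU] := orthonormal_rep_exists U; rewrite (gr_projE MU).
exact: orthoproj_gram MU.1.
Qed.

Lemma mxtrace_gr_proj n d (U : Gr R n d) : \tr (gr_proj U) = d%:R.
Proof.
have [M MU] := orthonormal_rep_exists U.
by rewrite (gr_projE MU) mxtrace_mulC MU.1 mxtrace1.
Qed.

Lemma frob_orthoproj_mul n (P Q : 'M[R]_n) : orthoproj P -> orthoproj Q ->
  frob (P *m Q) ^+ 2 = \tr (P *m Q).
Proof.
move=> [PT PP] [QT QQ]; rewrite frob_sqr trmx_mul PT QT -mulmxA (mulmxA P) PP.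
by rewrite mxtrace_mulC -mulmxA QQ.
Qed.

Lemma d2E n d (U V : Gr R n d) : d2 U V = frob (gr_proj_perp U *m gr_proj V).
Proof.
rewrite /d2 -frob_orthoproj_mul.
- by rewrite sqrtr_sqr ger0_norm.
- exact/orthoproj_compl/orthoproj_gr_proj.
- exact: orthoproj_gr_proj.
Qed.

Lemma d2_ge0 n d (U V : Gr R n d) : 0 <= d2 U V.
Proof. exact: sqrtr_ge0. Qed.

Lemma d2C n d (U V : Gr R n d) : d2 U V = d2 V U.
Proof.
rewrite /d2 /gr_proj_perp !mulmxBl !mul1mx !linearB /= !mxtrace_gr_proj.
by rewrite mxtrace_mulC.
Qed.

(** Insert the identity as the sum of the projector on [V] and its complement; the extra projectors
    have operator norm at most 1. *)
Lemma d2_triangle n d (U V W : Gr R n d) : d2 U W <= d2 U V + d2 V W.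
Proof.
rewrite !d2E.
have -> : gr_proj_perp U *m gr_proj W =
    gr_proj_perp U *m gr_proj V *m gr_proj W +
    gr_proj_perp U *m (gr_proj_perp V *m gr_proj W).
  by rewrite -mulmxA -mulmxDr -mulmxDl [gr_proj V + _]addrC subrK mul1mx.
apply: le_trans (frobD _ _) _; apply: lerD.
  rewrite -[leRHS]mul1r; apply: op_le_mulmxr => //.
  exact/orthoproj_op_le/orthoproj_gr_proj.
rewrite -[leRHS]mul1r; apply: op_le_mulmx => //.
exact/orthoproj_op_le/orthoproj_compl/orthoproj_gr_proj.
Qed.

Lemma d2_rep n d (U V : Gr R n d) (M : 'M[R]_(n, d)) : orthonormal_rep M V ->
  d2 V U = frob (gr_proj_perp U *m M).
Proof.
move=> MV; rewrite d2C d2E (gr_projE MV) -frobT trmx_mul trmx_mul trmxK -mulmxA.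
by rewrite (isometry_frob _ MV.1) -trmx_mul frobT.
Qed.

End Chordal.

(** * Gradient estimates: [P] projects on the target, [G] represents the iterate, [S] is signal, [E]
    is noise *)

Section GradientStep.
Variables (R : realType) (n d T : nat).
Variables (P : 'M[R]_n) (G : 'M[R]_(n, d)) (S E : 'M[R]_(n, T)).
Variables (smin smax r delta : R).
Hypotheses (oP : orthoproj P) (trP : \tr P = d%:R) (GG : G^T *m G = 1%:M).
Hypotheses (smin0 : 0 <= smin) (smax0 : 0 <= smax) (r0 : 0 <= r).
Hypothesis PS : P *m S = S.
Hypothesis S_le : op_le smax S.
Hypothesis S_ge : forall y : 'cV_n, smin * frob (P *m y) <= frob (S^T *m y).
Hypothesis noise_le : frob E <= delta.
Hypothesis G_le : frob ((1%:M - P) *m G) <= r.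

Let P' := 1%:M - P.
Let G' := 1%:M - G *m G^T.
(* The sum of sin^2 cos^2 of the principal angles between [P] and [G]. *)
Let q := frob (P *m (G *m G^T *m P')) ^+ 2.
(** Half the negative gradient is [V0 + N], the signal part plus the noise part; [eta] bounds the
    latter. *)
Let V0 := G' *m S *m S^T *m G.
Let N := G' *m (S *m E^T + E *m S^T + E *m E^T) *m G.
Let eta := 2 * smax * delta + delta ^+ 2.

Let PT : P^T = P. Proof. by case: oP. Qed.
Let PP : P *m P = P. Proof. by case: oP. Qed.
Let oP' : orthoproj P'. Proof. exact: orthoproj_compl. Qed.
Let P'T : P'^T = P'. Proof. by case: oP'. Qed.
Let P'P' : P' *m P' = P'. Proof. by case: oP'. Qed.
Let P'P : P' *m P = 0. Proof. by rewrite mulmxBl mul1mx PP subrr. Qed.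
Let PP' : P *m P' = 0. Proof. by rewrite mulmxBr mulmx1 PP subrr. Qed.
Let oG' : orthoproj G'. Proof. exact/orthoproj_compl/orthoproj_gram. Qed.
Let G_op : op_le 1 G.
Proof. by move=> y; rewrite isometry_frob // mul1r. Qed.
Let delta0 : 0 <= delta. Proof. exact: le_trans noise_le. Qed.

Lemma gradient_split : G' *m (S + E) *m (S + E)^T *m G = V0 + N.
Proof.
have WW : (S + E) *m (S + E)^T = S *m S^T + (S *m E^T + E *m S^T + E *m E^T).
  by rewrite [(S + E)^T]linearD /= mulmxDl !mulmxDr !addrA.
by rewrite -(mulmxA G') WW mulmxDr mulmxDl mulmxA.
Qed.

Lemma frob_gradient_noise_le : frob N <= eta.
Proof.
have SE : frob (S *m E^T) <= smax * delta.
  apply: le_trans (op_le_mulmx _ smax0 S_le) _.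
  by rewrite frobT ler_wpM2l.
rewrite /N; apply: le_trans (op_le_mulmxr _ _ G_op) _; rewrite ?mul1r //.
apply: le_trans (op_le_mulmx _ _ (orthoproj_op_le oG')) _; rewrite ?mul1r //.
apply: le_trans (frobD _ _) _; rewrite /eta; apply: lerD; last first.
  apply: le_trans (frob_mulmx _ _) _; rewrite frobT -expr2.
  by rewrite ler_sqr ?nnegrE.
apply: le_trans (frobD _ _) _.
have -> : frob (E *m S^T) = frob (S *m E^T) by rewrite -frobT trmx_mul trmxK.
by lra.
Qed.

(** Both squares equal d - tr(P G G^T), because [P] and [G *m G^T] have the same trace. *)
Lemma frob_complement_proj : frob (G' *m P) = frob (P' *m G).
Proof.
apply/eqP; rewrite -(eqrXn2 (n := 2)) // frob_orthoproj_mul // frob_sqr.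
rewrite trmx_mul P'T -mulmxA (mulmxA P') P'P' !mulmxBl mulmxBr !mul1mx GG.
rewrite !linearB /= trP mxtrace1 -mulmxA mxtrace_mulC mulmxA.
by apply/eqP; congr (_ - _); rewrite mxtrace_mulC mulmxA.
Qed.

Let frob_SSTG m (A : 'M[R]_(m, n)) : frob (A *m S *m S^T *m G) <= smax ^+ 2 * frob A.
Proof.
apply: le_trans (op_le_mulmxr _ _ G_op) _; rewrite ?mul1r //.
apply: le_trans (op_le_mulmxr _ smax0 (op_leT smax0 S_le)) _.
by rewrite expr2 -mulrA ler_wpM2l // op_le_mulmxr.
Qed.

Lemma frob_gradient_signal_le : frob V0 <= smax ^+ 2 * r.
Proof.
rewrite /V0 -{1}PS mulmxA; apply: le_trans (frob_SSTG _) _.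
by rewrite ler_wpM2l ?sqr_ge0 // frob_complement_proj.
Qed.

(** Since P S = S and P' P = 0, only - P' G G^T P remains of P' G' in front of [S]; its norm is the
    root of [q]. *)
Lemma frob_perp_gradient_signal_le : frob (P' *m V0) <= smax ^+ 2 * Num.sqrt q.
Proof.
have -> : P' *m V0 = - ((P *m (G *m G^T *m P'))^T *m S *m S^T *m G).
  rewrite /V0 -{1}PS !mulmxA -!mulNmx; do 3 congr (_ *m _).
  rewrite /G' mulmxBr mulmx1 mulmxBl P'P sub0r !trmx_mul trmxK P'T PT.
  by rewrite !mulmxA.
rewrite frobN; apply: le_trans (frob_SSTG _) _.
by rewrite frobT /q sqrtr_sqr ger0_norm.
Qed.

(** As S^T P' = 0, the trace is exactly minus the squared norm of S^T G G^T P', to which [S_ge]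
    applies. *)
Lemma gradient_signal_descent : \tr (V0^T *m (P' *m G)) <= - (smin ^+ 2 * q).
Proof.
have STP' : S^T *m P' = 0 by rewrite -PS trmx_mul PT -mulmxA PP' mulmx0.
pose X := G *m G^T *m P'.
have -> : \tr (V0^T *m (P' *m G)) = - frob (S^T *m X) ^+ 2.
  rewrite /V0 (trmx_mul _ G) (trmx_mul _ S^T) (trmx_mul _ S) trmxK oG'.1 -!mulmxA.
  have -> : S^T *m (G' *m (P' *m G)) = - (S^T *m X *m G).
    rewrite [G' *m _]mulmxBl mul1mx mulmxBr (mulmxA S^T) STP' mul0mx sub0r.
    by rewrite /X !mulmxA.
  rewrite !mulmxN linearN frob_sqr /=; congr (- _).
  rewrite mulmxA mxtrace_mulC.
  have -> : S^T *m X *m G *m (G^T *m S) = S^T *m X *m (S^T *m X)^T.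
    rewrite [in RHS]/X (trmx_mul S^T) trmxK (trmx_mul _ P') P'T trmx_mul trmxK.
    by rewrite -!mulmxA (mulmxA P') /X -!mulmxA (mulmxA P' P') P'P'.
  by rewrite mxtrace_mulC.
rewrite lerN2 -exprMn ler_sqr ?nnegrE ?mulr_ge0 //.
exact: frob_mulmx_ge.
Qed.

Lemma sin2cos2_sum_le : q <= frob (P' *m G) ^+ 2.
Proof.
rewrite /q ler_sqr ?nnegrE //.
apply: le_trans (op_le_mulmx _ _ (orthoproj_op_le oP)) _; rewrite ?mul1r //.
by rewrite -mulmxA isometry_frob // -frobT trmx_mul trmxK P'T.
Qed.

(** By Pythagoras |P G y|^2 = |y|^2 - |P' G y|^2 is at least (1 - r^2) |y|^2, the lower bound on the
    squared cosines; it is applied to the columns of G^T P'. *)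
Lemma sin2cos2_sum_ge : r < 1 -> (1 - r ^+ 2) * frob (P' *m G) ^+ 2 <= q.
Proof.
move=> r1; rewrite /q.
have r21 : 0 <= 1 - r ^+ 2 by rewrite subr_ge0 expr_le1 // ltW.
have -> : frob (P' *m G) = frob (G^T *m P') by rewrite -frobT trmx_mul P'T.
rewrite -{1}(sqr_sqrtr r21) -exprMn ler_sqr ?nnegrE ?mulr_ge0 ?sqrtr_ge0 //.
rewrite -mulmxA mulmxA -[X in _ * frob X <= _]mul1mx.
apply: frob_mulmx_ge; rewrite ?sqrtr_ge0 // => y; rewrite mul1mx.
rewrite -ler_sqr ?nnegrE ?mulr_ge0 ?sqrtr_ge0 // exprMn sqr_sqrtr //.
have := orthoproj_pythagoras (G *m y) oP; rewrite isometry_frob // !mulmxA.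
have : frob (P' *m G *m y) ^+ 2 <= r ^+ 2 * frob y ^+ 2.
  rewrite -exprMn ler_sqr ?nnegrE ?mulr_ge0 //.
  by apply: le_trans (frob_mulmx _ _) _; rewrite ler_wpM2r.
rewrite -/P'; lra.
Qed.

(** The signal contributes -4 alpha smin^2 q from the linear term and at most 8 alpha^2 smax^4 q
    from the quadratic one. The sum is a nonpositive multiple of [q], so the lower bound on [q]
    turns it into the rate. *)
Lemma descent_bound (alpha : R) (V : 'M[R]_(n, d)) :
  V = (2 * alpha) *: (G' *m (S + E) *m (S + E)^T *m G) ->
  0 <= alpha -> r < 1 ->
  0 <= alpha * smin ^+ 2 - 2 * alpha ^+ 2 * smax ^+ 4 ->
  frob (P' *m G) ^+ 2 + 2 * \tr ((P' *m G)^T *m (P' *m V)) + 2 * frob (P' *m V) ^+ 2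
  <= contraction_rate alpha smin smax r * frob (P' *m G) ^+ 2
     + gamma_noise alpha smax r delta.
Proof.
move=> VE a0 r1 step_ge0.
have eta0 : 0 <= eta by rewrite addr_ge0 ?mulr_ge0 ?sqr_ge0.
have trV : \tr ((P' *m G)^T *m (P' *m V)) =
    2 * alpha * (\tr (V0^T *m (P' *m G)) + \tr (N^T *m (P' *m G))).
  rewrite -mxtrace_tr trmx_mul trmxK trmx_mul P'T -mulmxA (mulmxA P') P'P'.
  rewrite VE gradient_split trmxZ -scalemxAl mxtraceZ.
  by rewrite [(V0 + N)^T]linearD /= mulmxDl linearD.
have trN : \tr (N^T *m (P' *m G)) <= eta * r.
  apply: le_trans (frob_CauchySchwarz _ _) _.
  exact: ler_pM frob_gradient_noise_le G_le.
have f_le : frob (P' *m G) ^+ 2 <= r ^+ 2 by rewrite ler_sqr ?nnegrE.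
have q0 : 0 <= q by exact: sqr_ge0.
have sq_le : Num.sqrt q <= r.
  by rewrite -(ger0_norm r0) -sqrtr_sqr ler_wsqrtr // (le_trans sin2cos2_sum_le).
have PV : frob (P' *m V) ^+ 2 <=
    4 * alpha ^+ 2 * (smax ^+ 4 * q + 2 * (smax ^+ 2 * r * eta) + eta ^+ 2).
  rewrite VE gradient_split -scalemxAr frobZ exprMn real_normK ?num_real //.
  rewrite (_ : (2 * alpha) ^+ 2 = 4 * alpha ^+ 2); last by ring.
  rewrite ler_wpM2l ?mulr_ge0 ?sqr_ge0 //.
  apply: (@le_trans _ _ ((smax ^+ 2 * Num.sqrt q + eta) ^+ 2)).
    rewrite ler_sqr ?nnegrE ?addr_ge0 ?mulr_ge0 ?sqrtr_ge0 ?sqr_ge0 //.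
    rewrite mulmxDr; apply: le_trans (frobD _ _) _.
    apply: lerD; first exact: frob_perp_gradient_signal_le.
    apply: le_trans (op_le_mulmx _ _ (orthoproj_op_le oP')) _; rewrite ?mul1r //.
    exact: frob_gradient_noise_le.
  rewrite sqrrD exprMn sqr_sqrtr // -exprM mulr2n.
  (* Only in this signal-noise cross term is the root of [q] replaced by [r]. *)
  have : smax ^+ 2 * Num.sqrt q * eta <= smax ^+ 2 * r * eta.
    by rewrite ler_wpM2r // ler_wpM2l ?sqr_ge0.
  by lra.
have desc := gradient_signal_descent.
have qf : (alpha * smin ^+ 2 - 2 * alpha ^+ 2 * smax ^+ 4)
     * ((1 - r ^+ 2) * frob (P' *m G) ^+ 2)
   <= (alpha * smin ^+ 2 - 2 * alpha ^+ 2 * smax ^+ 4) * q.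
  by rewrite ler_wpM2l // sin2cos2_sum_ge.
have trV_le : \tr ((P' *m G)^T *m (P' *m V)) <=
    2 * alpha * (- (smin ^+ 2 * q) + eta * r).
  by rewrite trV ler_wpM2l ?mulr_ge0 // lerD.
have -> : gamma_noise alpha smax r delta = 4 * alpha * (eta * r)
    + 8 * alpha ^+ 2 * (2 * (smax ^+ 2 * r * eta) + eta ^+ 2).
  by rewrite /gamma_noise /eta; ring.
rewrite /contraction_rate; move: qf trV_le PV.
move: (\tr _) (frob (P' *m V) ^+ 2) (frob (P' *m G) ^+ 2) (smax ^+ 4) => t v f s4.
lra.
Qed.

Lemma frob_gradient_le (alpha : R) : 0 <= alpha ->
  frob ((2 * alpha) *: (G' *m (S + E) *m (S + E)^T *m G)) <=
    2 * alpha * (smax ^+ 2 * r + eta).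
Proof.
move=> a0; rewrite frobZ ger0_norm ?mulr_ge0 // gradient_split.
rewrite ler_wpM2l ?mulr_ge0 //; apply: le_trans (frobD _ _) _.
by rewrite lerD ?frob_gradient_signal_le ?frob_gradient_noise_le.
Qed.

End GradientStep.

(** * Consequences of the step size condition *)

Section StepSize.
Variable R : realType.
Variables (alpha smin smax r : R).
Hypothesis hsig : 0 < smin <= smax.
Hypothesis halpha : 0 < alpha < smin ^+ 2 / (2 * smax ^+ 4).
Hypothesis hr : 0 <= r < 1.
Let rho := contraction_rate alpha smin smax r.

Lemma step_gain_gt0 : 0 < alpha * smin ^+ 2 - 2 * alpha ^+ 2 * smax ^+ 4.
Proof.
move: hsig halpha => /andP[smin0 le_s] /andP[a0].
have s4 : 0 < 2 * smax ^+ 4 by rewrite mulr_gt0 // exprn_gt0 // (lt_le_trans smin0).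
rewrite ltr_pdivlMr // => a_lt.
have -> : alpha * smin ^+ 2 - 2 * alpha ^+ 2 * smax ^+ 4 =
    alpha * (smin ^+ 2 - alpha * (2 * smax ^+ 4)) by ring.
by rewrite mulr_gt0 // subr_gt0.
Qed.

(** With x = alpha smax^2 the gain is at most x - 2 x^2, whose maximum 1/8 is attained at x = 1/4;
    hence the square of 4 x - 1. *)
Lemma step_gain_le : alpha * smin ^+ 2 - 2 * alpha ^+ 2 * smax ^+ 4 <= 1 / 8.
Proof.
move: hsig halpha => /andP[smin0 le_s] /andP[a0 _].
have : alpha * smin ^+ 2 <= alpha * smax ^+ 2.
  rewrite ler_wpM2l ?(ltW a0) // ler_sqr ?nnegrE ?(ltW smin0) //.
  exact: le_trans (ltW smin0) le_s.
have := sqr_ge0 (4 * (alpha * smax ^+ 2) - 1).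
have -> : (4 * (alpha * smax ^+ 2) - 1) ^+ 2 =
   16 * (alpha ^+ 2 * smax ^+ 4) - 8 * (alpha * smax ^+ 2) + 1 by ring.
lra.
Qed.

Let r2_lt1 : r ^+ 2 < 1.
Proof. by move: hr => /andP[r0 r1]; rewrite expr_lt1. Qed.

Lemma contraction_rate_lt1 : rho < 1.
Proof.
rewrite /rho /contraction_rate ltrBlDr ltrDl mulr_gt0 ?step_gain_gt0 //.
by rewrite mulr_gt0 // subr_gt0.
Qed.

Lemma contraction_rate_ge : 1 - rho <= (1 - r ^+ 2) / 2.
Proof.
rewrite /rho /contraction_rate opprB addrC subrK.
have : (1 - r ^+ 2) * (alpha * smin ^+ 2 - 2 * alpha ^+ 2 * smax ^+ 4) <=
    (1 - r ^+ 2) * (1 / 8).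
  by rewrite ler_wpM2l ?step_gain_le // subr_ge0 ltW.
lra.
Qed.

Lemma contraction_rate_gt0 : 0 < rho.
Proof. have := contraction_rate_ge; have := sqr_ge0 r; lra. Qed.

(* The noise condition forces every rotation angle of a step to be at most 1. *)
Lemma gradient_step_small (delta : R) : 0 <= delta ->
  gamma_noise alpha smax r delta <= (1 - rho) * r ^+ 2 ->
  2 * alpha * (smax ^+ 2 * r + (2 * smax * delta + delta ^+ 2)) <= 1.
Proof.
move: hsig halpha hr => /andP[smin0 le_s] /andP[a0 a_lt] /andP[r0 r1] d0 noise.
have s0 : 0 < smax by exact: lt_le_trans le_s.
pose nu := 2 * alpha * (2 * smax * delta + delta ^+ 2).
pose beta := alpha * smax ^+ 2.
have nu0 : 0 <= nu.
  rewrite /nu mulr_ge0 ?mulr_ge0 ?(ltW a0) // addr_ge0 ?sqr_ge0 //.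
  by rewrite !mulr_ge0 // ltW.
have beta0 : 0 <= beta by rewrite mulr_ge0 ?sqr_ge0 ?ltW.
have beta_lt : beta <= 1 / 2.
  rewrite /beta; have s4 : 0 < 2 * smax ^+ 4 by rewrite mulr_gt0 // exprn_gt0.
  have : alpha * smax ^+ 2 * (2 * smax ^+ 2) <= smax ^+ 2.
    move: a_lt; rewrite ltr_pdivlMr // => a_lt.
    have -> : alpha * smax ^+ 2 * (2 * smax ^+ 2) = alpha * (2 * smax ^+ 4) by ring.
    by rewrite (le_trans (ltW a_lt)) // ler_sqr ?nnegrE ?(ltW smin0) ?(ltW s0).
  have s2 : 0 < smax ^+ 2 by rewrite exprn_gt0.
  by rewrite mulrA ger_pMl //; lra.
(* Rewritten in [nu], the noise condition bounds 2 nu r alone by (1 - r^2) r^2 / 2; dividing by 2 r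
   bounds [nu] when r is positive. *)
have gE : gamma_noise alpha smax r delta =
    2 * nu * r + 8 * beta * r * nu + 2 * nu ^+ 2.
  by rewrite /gamma_noise /nu /beta; ring.
have -> : 2 * alpha * (smax ^+ 2 * r + (2 * smax * delta + delta ^+ 2)) =
    2 * (beta * r) + nu by rewrite /beta /nu; ring.
have g_le : 2 * nu * r + 8 * beta * r * nu + 2 * nu ^+ 2 <=
    (1 - r ^+ 2) / 2 * r ^+ 2.
  by rewrite -gE (le_trans noise) // ler_wpM2r ?sqr_ge0 // contraction_rate_ge.
have br : beta * r <= 1 / 2 * r by rewrite ler_wpM2r.
have t1 : 0 <= 8 * beta * r * nu by rewrite mulr_ge0 // mulr_ge0 // mulr_ge0.
have [r_eq0|r_neq0] := eqVneq r 0.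
  have : nu ^+ 2 <= 0 by move: g_le; rewrite r_eq0; lra.
  by rewrite real_exprn_even_le0 ?num_real //= => /eqP ->; rewrite r_eq0; lra.
have rp : 0 < r by rewrite lt0r r_neq0.
have nu_le : nu <= r * (1 - r ^+ 2) / 4.
  rewrite -(ler_pM2l (mulr_gt0 (ltr0n R 2) rp)).
  have := sqr_ge0 nu.
  have -> : 2%:R * r * (r * (1 - r ^+ 2) / 4) = (1 - r ^+ 2) / 2 * r ^+ 2 by field.
  lra.
(* The goal is now implied by r + r (1 - r^2) / 4 <= 1, that is 4 - 5 r + r^3 >= 0, which factors in
   this way. *)
have : 0 <= (1 - r) * (4 - r - r ^+ 2).
  by apply: mulr_ge0; [lra | have := r2_lt1; lra].
lra.
Qed.

End StepSize.

(** * From the tangent vector to the next subspace *)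

Section ExpStep.
Variable R : realType.
Implicit Types n d T : nat.

(** Column j of [Q] is orthogonal to [M] unless s_j = 0, and then sin s_j = 0 as well. *)
Lemma mul_diag_sin n d (M Q : 'M[R]_(n, d)) (s : 'rV[R]_d) :
  M^T *m (Q *m diag_mx s) = 0 -> M^T *m (Q *m diag_mx (map_mx sin s)) = 0.
Proof.
rewrite !mulmxA => Ms0; apply/matrixP => i j.
have /matrixP/(_ i j) := Ms0; rewrite !mul_mx_diag !mxE => /eqP.
by rewrite mulf_eq0 => /orP[]/eqP->; rewrite ?mul0r ?sin0 ?mulr0.
Qed.

Lemma exp_orthonormal n d (M Q : 'M[R]_(n, d)) (s : 'rV[R]_d) :
  M^T *m M = 1%:M -> Q^T *m Q = 1%:M -> M^T *m (Q *m diag_mx s) = 0 ->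
  let X := M *m diag_mx (map_mx cos s) + Q *m diag_mx (map_mx sin s) in
  X^T *m X = 1%:M.
Proof.
move=> MM QQ /mul_diag_sin Ms0 X; rewrite /X [(_ + _)^T]linearD /= mulmxDl !mulmxDr.
have cross : (M *m diag_mx (map_mx cos s))^T *m (Q *m diag_mx (map_mx sin s)) = 0.
  by rewrite trmx_mul -mulmxA Ms0 mulmx0.
rewrite cross.
have -> : (Q *m diag_mx (map_mx sin s))^T *m (M *m diag_mx (map_mx cos s)) = 0.
  by rewrite -[LHS]trmxK trmx_mul trmxK cross trmx0.
rewrite addr0 add0r !trmx_mul -!mulmxA (mulmxA M^T) MM mul1mx.
rewrite (mulmxA Q^T) QQ mul1mx.
rewrite !tr_diag_mx !mulmx_diag -linearD /=.
apply/matrixP => i j; rewrite !mxE -!expr2 cos2Dsin2.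
by [].
Qed.

Lemma colspan_mulmx_unit n d (X : 'M[R]_(n, d)) (Q : 'M[R]_d) :
  Q^T *m Q = 1%:M -> colspan (X *m Q^T) = colspan X.
Proof.
move=> QQ; apply/vspaceP => x; apply/colspanP/colspanP => -[y ->].
  by exists (Q^T *m y); rewrite mulmxA.
by exists (Q *m y); rewrite -mulmxA (mulmxA Q^T) QQ mul1mx.
Qed.

(* Right multiplication by [Q2] replaces the representative [M] of the base
   point by the one aligned with the singular value decomposition. *)
Lemma is_Exp_d2_le n d (M V : 'M[R]_(n, d)) (G H U : Gr R n d) :
  orthonormal_rep M G -> is_Exp M V H -> frob V <= 1 ->
  d2 H U ^+ 2 <= frob (gr_proj_perp U *m M) ^+ 2
    + 2 * \tr ((gr_proj_perp U *m M)^T *m (gr_proj_perp U *m V))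
    + 2 * frob (gr_proj_perp U *m V) ^+ 2.
Proof.
move=> [MM cM] [MV [Q1 [s [Q2 [[Q11 Q22 s0 VE] cH]]]]] V1.
set P' := gr_proj_perp U.
have Q22' := mulmx1C Q22.
have VQ : V *m Q2 = Q1 *m diag_mx s by rewrite VE -mulmxA Q22 mulmx1.
pose N := M *m Q2.
have NN : N^T *m N = 1%:M.
  by rewrite trmx_mul -mulmxA (mulmxA M^T) MM mul1mx.
have NQs : N^T *m (Q1 *m diag_mx s) = 0.
  by rewrite -VQ trmx_mul -mulmxA (mulmxA M^T) MV mul0mx mulmx0.
have XX := exp_orthonormal NN Q11 NQs.
set X := _ + _ in XX.
have XH : orthonormal_rep X H.
  split; first exact: XX.
  by rewrite -cH -mulmxDl colspan_mulmx_unit.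
rewrite (d2_rep U XH) /X mulmxDr (mulmxA P' N) (mulmxA P' Q1).
(* The angle s_j is the norm of column j of V Q2, and |V Q2| = |V|. *)
have s01 j : 0 <= s 0 j <= 1.
  rewrite s0 /= -(ger0_norm (s0 j)); apply: le_trans V1.
  rewrite -(frob_mulmx_row V Q22') VQ.
  apply: le_trans (frob_col_le _ j); rewrite col_mul_diag frobZ.
  have -> : frob (col j Q1) = 1; last by rewrite mulr1.
  apply/eqP; rewrite -(eqrXn2 (n := 2)) // expr1n frob_sqr trace_mx11.
  apply/eqP; transitivity ((Q1^T *m Q1) j j); last by rewrite Q11 mxE eqxx.
  by rewrite !mxE; apply: eq_bigr => i _; rewrite !mxE.
apply: le_trans (geodesic_bound (P' *m N) (P' *m Q1) s01) _.
rewrite -!mulmxA -VQ /N !mulmxA !(frob_mulmx_row _ Q22').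
rewrite (trmx_mul _ Q2) -!mulmxA [in X in X <= _]mxtrace_mulC.
by rewrite -!mulmxA Q22' mulmx1.
Qed.

(** The projector on [U] splits [W] into signal and noise; the geodesic estimate [is_Exp_d2_le] is
    then fed to [descent_bound]. *)
Theorem gradient_step_d2 n d T (alpha smin smax r delta : R) (W : 'M[R]_(n, T))
    (G H U : Gr R n d) :
  0 < smin <= smax -> 0 < alpha < smin ^+ 2 / (2 * smax ^+ 4) -> 0 <= r < 1 ->
  op_le smax (gr_proj U *m W) ->
  (forall y : 'cV_n,
     smin * frob (gr_proj U *m y) <= frob ((gr_proj U *m W)^T *m y)) ->
  frob (gr_proj_perp U *m W) <= delta ->
  gamma_noise alpha smax r delta <=
    (1 - contraction_rate alpha smin smax r) * r ^+ 2 ->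
  gradient_step alpha W G H -> d2 G U <= r ->
  d2 H U ^+ 2 <= contraction_rate alpha smin smax r * d2 G U ^+ 2
    + gamma_noise alpha smax r delta.
Proof.
move=> hsig halpha hr S_le S_ge E_le noise [M MG expH] GU_le.
have [/andP[smin0 le_s] /andP[a0 _] /andP[r0 r1]] := And3 hsig halpha hr.
have smax0 : 0 <= smax by rewrite (le_trans (ltW smin0)).
have oP := orthoproj_gr_proj U.
have WE : W = gr_proj U *m W + gr_proj_perp U *m W.
  by rewrite -mulmxDl [gr_proj U + _]addrC subrK mul1mx.
pose V := - alpha *: grad_cost W G M.
have VE : V = (2 * alpha) *: ((1%:M - M *m M^T)
    *m (gr_proj U *m W + gr_proj_perp U *m W)
    *m (gr_proj U *m W + gr_proj_perp U *m W)^T *m M).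
  rewrite -WE /V /grad_cost /gr_proj_perp (gr_projE MG) scalerA.
  by congr (_ *: _); ring.
have PS : gr_proj U *m (gr_proj U *m W) = gr_proj U *m W by rewrite mulmxA oP.2.
have GU_le' : frob ((1%:M - gr_proj U) *m M) <= r by rewrite -(d2_rep U MG).
(* This keeps every rotation angle at most 1, and is where the noise condition enters. *)
have V1 : frob V <= 1.
  have d0 : 0 <= delta by exact: le_trans E_le.
  apply: le_trans (gradient_step_small hsig halpha hr d0 noise); rewrite VE.
  apply: (frob_gradient_le oP (mxtrace_gr_proj U) MG.1) => //.
  exact: ltW.
apply: le_trans (is_Exp_d2_le U MG expH V1) _; rewrite (d2_rep U MG).
exact: (descent_bound oP MG.1 (ltW smin0) smax0 r0 PS S_le
  S_ge E_le GU_le' VE (ltW a0) r1 (ltW (step_gain_gt0 hsig halpha))).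
Qed.

End ExpStep.

(** * Noise *)

Section Noise.
Variable R : realType.
Implicit Types n d T t : nat.

Lemma frob_le_col n m p (A : 'M[R]_(n, m)) (B : 'M[R]_(p, m)) :
  (forall j, frob (col j A) <= frob (col j B)) -> frob A <= frob B.
Proof.
move=> AB; apply: frob_le; rewrite !frob_sqr_col.
by apply: ler_sum => j _; rewrite ler_sqr ?nnegrE.
Qed.

Lemma frob_le_sqrt n m (A : 'M[R]_(n, m)) (k : R) : 0 <= k ->
  (forall j, frob (col j A) <= k) -> frob A <= k * Num.sqrt m%:R.
Proof.
move=> k0 Ak; rewrite -ler_sqr ?nnegrE ?mulr_ge0 ?sqrtr_ge0 //.
rewrite frob_sqr_col exprMn sqr_sqrtr // mulr_natr.
apply: le_trans (_ : \sum_(j < m) k ^+ 2 <= _).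
  by apply: ler_sum => j _; rewrite ler_sqr ?nnegrE.
by rewrite sumr_const card_ord.
Qed.

Lemma gr_proj_perp_mem n d (U : Gr R n d) (x : 'cV[R]_n) :
  x \in val U -> gr_proj_perp U *m x = 0.
Proof.
have [M MU] := orthonormal_rep_exists U.
rewrite -MU.2 => /colspanP[y ->]; rewrite /gr_proj_perp (gr_projE MU).
by rewrite mulmxBl mul1mx mulmxA -(mulmxA M) MU.1 mulmx1 subrr.
Qed.

Lemma orthoproj_gr_proj_perp n d (U : Gr R n d) : orthoproj (gr_proj_perp U).
Proof. exact/orthoproj_compl/orthoproj_gr_proj. Qed.

Lemma frob_gr_proj_perp_le n d p (U : Gr R n d) (A : 'M[R]_(n, p)) :
  frob (gr_proj_perp U *m A) <= frob A.
Proof.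
rewrite -[leRHS]mul1r; apply: op_le_mulmx => //.
exact/orthoproj_op_le/orthoproj_gr_proj_perp.
Qed.

Section Window.
Variables (n d : nat) (U : nat -> Gr R n d) (u : nat -> 'cV[R]_n) (eps c : R).
Hypotheses (eps0 : 0 <= eps) (c0 : 0 <= c).
Hypothesis A1 : forall t, (1 <= t)%N -> exists ubar e : 'cV[R]_n,
  [/\ u t = ubar + e, ubar \in val (U t) & frob e <= eps].
Hypothesis A2 : forall t, (1 <= t)%N -> d2 (U t) (U t.+1) <= c.

Lemma sample_noise_le t : (1 <= t)%N -> frob (gr_proj_perp (U t) *m u t) <= eps.
Proof.
move=> t1; have [ubar [e [-> mem_ubar e_le]]] := A1 t1.
by rewrite mulmxDr gr_proj_perp_mem // add0r (le_trans (frob_gr_proj_perp_le _ _)).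
Qed.

Lemma d2_drift s k : (1 <= s)%N -> d2 (U (s + k)%N) (U s) <= k%:R * c.
Proof.
move=> s1; elim: k => [|k IH].
  by rewrite addn0 d2E mul0r mulmxBl mul1mx (orthoproj_gr_proj _).2 subrr
    -(scale0r (0 : 'M[R]_n)) frobZ normr0 mul0r.
apply: le_trans (d2_triangle _ (U (s + k)%N) _) _.
rewrite -natr1 mulrDl mul1r addrC lerD // addnS d2C A2 //.
exact: leq_trans (leq_addr _ _).
Qed.

(** Split each sample by the projector on its own subspace: the part inside leaves [U t] by at most
    the accumulated drift times the norm of the sample, the part outside is at most [eps]. *)
Lemma window_noise_le T t : (1 <= T <= t)%N ->
  frob (gr_proj_perp (U t) *m window u T t) <= delta_noise u T c eps t.
Proof.
move=> /andP[T1 Tt]; pose s (j : 'I_T) := (t - T + j).+1.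
have colW j : col j (window u T t) = u (s j).
  by apply/colP => i; rewrite !mxE.
pose E1 := \matrix_(i < n, j < T)
  (gr_proj_perp (U t) *m (gr_proj (U (s j)) *m u (s j))) i 0.
pose E2 := \matrix_(i < n, j < T)
  (gr_proj_perp (U t) *m (gr_proj_perp (U (s j)) *m u (s j))) i 0.
have colE1 j : col j E1 = gr_proj_perp (U t) *m (gr_proj (U (s j)) *m u (s j)).
  by apply/colP => i; rewrite !mxE.
have colE2 j : col j E2 = gr_proj_perp (U t) *m (gr_proj_perp (U (s j)) *m u (s j)).
  by apply/colP => i; rewrite !mxE.
have -> : gr_proj_perp (U t) *m window u T t = E1 + E2.
  apply/matrixP => i j; transitivity (col j (gr_proj_perp (U t) *m window u T t) i 0).
    by rewrite [RHS]mxE.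
  rewrite colE -mulmxA -colE colW [RHS]mxE [E1 i j]mxE [E2 i j]mxE.
  transitivity ((gr_proj_perp (U t) *m (gr_proj (U (s j)) *m u (s j)) +
     gr_proj_perp (U t) *m (gr_proj_perp (U (s j)) *m u (s j))) i 0).
    by rewrite -mulmxDr -mulmxDl [gr_proj (U (s j)) + _]addrC subrK mul1mx.
  by rewrite [LHS]mxE.
apply: le_trans (frobD _ _) _; rewrite /delta_noise; apply: lerD.
  rewrite -(ger0_norm c0) -frobZ; apply: frob_le_col => j.
  rewrite colE1 scalemxAr mulmxA.
  apply: le_trans (frob_mulmx _ _) _; rewrite -d2E.
  have -> : col j (window u T t *m (c *: diag_mx (\row_(j < T) (T.-1 - j)%:R))) =
      (c * (T.-1 - j)%:R) *: u (s j).
    by apply/colP => i; rewrite -scalemxAr mul_mx_diag !mxE; ring.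
  rewrite frobZ ler_wpM2r // ger0_norm ?mulr_ge0 // mulrC.
  (* Column j, counted from 0, is T - 1 - j steps older than [t]: this is the diagonal of D. *)
  have tE : t = (s j + (T.-1 - j))%N by rewrite /s; have := ltn_ord j; lia.
  by rewrite {1}tE d2_drift.
apply: le_trans (frob_le_sqrt eps0 _) _ => [j|].
  rewrite colE2; apply: le_trans (frob_gr_proj_perp_le _ _) _.
  exact: sample_noise_le.
rewrite ler_peMr ?mulr_ge0 ?sqrtr_ge0 // lerDr mulr_ge0 //.
Qed.

Variables (T : nat) (smax : R).
Hypothesis T1 : (1 <= T)%N.
Hypothesis A3 : forall t, (T <= t)%N -> op_le smax (gr_proj (U t) *m window u T t).

(* [sup] is 0 on unbounded sets, so that [delta_noise_le_sup] needs a bound on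
   the samples. *)
Lemma sample_bounded : exists b, 0 <= b /\ forall t, (1 <= t)%N -> frob (u t) <= b.
Proof.
have smax0 : 0 <= smax.
  (* A nonzero basis vector, available as [T] is positive, forces [smax] to be nonnegative. *)
  have := A3 (leqnn T) (delta_mx (Ordinal T1) 0).
  move=> /(le_trans (frob_ge0 _)); rewrite pmulr_lge0 // lt0r frob_ge0 andbT.
  apply/negP => /eqP/frob_eq0/matrixP/(_ (Ordinal T1) 0)/eqP.
  by rewrite !mxE !eqxx oner_eq0.
(* The finite sum covers the samples before [T]; a later one is the last column of its own window,
   so [A3] bounds its projection and [eps] the rest. *)
exists (\sum_(s < T) frob (u s) + (smax + eps)); split.
  by rewrite !addr_ge0 // sumr_ge0.
move=> t t1; have [tT|Tt] := ltnP t T.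
  rewrite (bigD1 (Ordinal tT)) //= -addrA lerDl !addr_ge0 //.
  by rewrite sumr_ge0.
apply: le_trans (_ : smax + eps <= _); last by rewrite lerDr sumr_ge0.
have -> : u t = gr_proj (U t) *m u t + gr_proj_perp (U t) *m u t.
  by rewrite -mulmxDl [gr_proj (U t) + _]addrC subrK mul1mx.
apply: le_trans (frobD _ _) _; apply: lerD; last exact: sample_noise_le.
have T1' : (T.-1 < T)%N by rewrite prednK.
have {1}-> : u t = window u T t *m delta_mx (Ordinal T1') 0.
  rewrite -colE; apply/colP => i; rewrite !mxE /=; congr (u _ i 0).
  by lia.
rewrite mulmxA; apply: le_trans (A3 Tt _) _.
suff -> : frob (delta_mx (Ordinal T1') 0 : 'cV[R]_T) = 1 by rewrite mulr1.
apply/eqP; rewrite -(eqrXn2 (n := 2)) // expr1n frob_sqr trmx_delta mul_delta_mx.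
by rewrite trace_mx11 mxE eqxx.
Qed.

Lemma delta_noise_ge0 t : 0 <= delta_noise u T c eps t.
Proof.
by rewrite /delta_noise addr_ge0 ?mulr_ge0 ?sqrtr_ge0 ?addr_ge0 ?mulr_ge0.
Qed.

Lemma delta_noise_le_sup t : (T <= t)%N ->
  delta_noise u T c eps t <= delta_noise_sup u T c eps.
Proof.
move=> Tt; rewrite -[leLHS]ger0_norm ?delta_noise_ge0 //.
apply: ub_le_sup; last by exists t.
have [b [b0 ub]] := sample_bounded.
pose D : 'M[R]_T := diag_mx (\row_(j < T) (T.-1 - j)%:R).
exists (c * (b * Num.sqrt T%:R * frob D) + eps * Num.sqrt T%:R * (c * (T.-1)%:R + 1)).
move=> _ [k /= Tk <-]; rewrite ger0_norm ?delta_noise_ge0 //.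
rewrite /delta_noise lerD2r ler_wpM2l // -/D.
apply: le_trans (frob_mulmx _ _) _; rewrite ler_wpM2r //.
apply: frob_le_sqrt => // j.
have -> : col j (window u T k) = u (k - T + j).+1 by apply/colP => i; rewrite !mxE.
exact: ub.
Qed.

End Window.

Lemma gamma_noise_le (alpha smax r s s' : R) : 0 <= alpha -> 0 <= smax -> 0 <= r ->
  0 <= s <= s' -> gamma_noise alpha smax r s <= gamma_noise alpha smax r s'.
Proof.
move=> a0 m0 r0 /andP[s0 ss]; have s'0 := le_trans s0 ss.
have a20 := sqr_ge0 alpha; have m20 := sqr_ge0 smax.
have ss2 : s ^+ 2 <= s' ^+ 2 by rewrite ler_pXn2r ?nnegrE.
have ss3 : s ^+ 3 <= s' ^+ 3 by rewrite ler_pXn2r ?nnegrE.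
have ss4 : s ^+ 4 <= s' ^+ 4 by rewrite ler_pXn2r ?nnegrE.
have c1 : 0 <= 8 * alpha * r * smax * (1 + 4 * alpha * smax ^+ 2).
  by rewrite !mulr_ge0 // addr_ge0 // !mulr_ge0.
have c2 : 0 <= 4 * alpha * r + 16 * alpha ^+ 2 * smax ^+ 2 * (r + 2).
  by rewrite addr_ge0 ?mulr_ge0 // ?addr_ge0 // ?mulr_ge0.
have c3 : 0 <= 32 * alpha ^+ 2 * smax by rewrite !mulr_ge0.
have c4 : 0 <= 8 * alpha ^+ 2 by rewrite !mulr_ge0.
by rewrite /gamma_noise !lerD // ler_wpM2l.
Qed.

End Noise.

(** * Recursion *)

Section Recursion.
Variable R : realType.

(** The step estimate is available only below [B], so this bound is carried along; it is preserved
    because rho B + g <= B. *)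
Lemma inner_recursion (z : nat -> R) (K : nat) (rho g B : R) :
  0 < rho < 1 -> z 0 <= B -> g <= (1 - rho) * B ->
  (forall k, (k < K)%N -> z k <= B -> z k.+1 <= rho * z k + g) ->
  forall k, (k <= K)%N ->
    z k <= B /\ z k <= rho ^+ k * z 0 + (1 - rho ^+ k) / (1 - rho) * g.
Proof.
move=> /andP[rho0 rho1] z0 gB step; elim=> [_|k IH kK].
  by split=> //; rewrite expr0 mul1r subrr !mul0r addr0.
have [zB zk] := IH (ltnW kK); have zk1 := step k kK zB.
have le1 : rho * z k <= rho * B by rewrite ler_wpM2l // ltW.
split; first by lra.
apply: le_trans zk1 _.
have := ler_wpM2l (ltW rho0) zk.
have -> : rho ^+ k.+1 * z 0 + (1 - rho ^+ k.+1) / (1 - rho) * g =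
    rho * (rho ^+ k * z 0 + (1 - rho ^+ k) / (1 - rho) * g) + g.
  by rewrite exprS; field; rewrite subr_eq0 gt_eqF.
by rewrite lerD2r.
Qed.

Lemma outer_recursion (x : nat -> R) (q a : R) : 0 <= q < 1 ->
  (forall m, x m.+1 <= q * x m + a) ->
  forall m, x m <= q ^+ m * x 0 + (1 - q ^+ m) / (1 - q) * a.
Proof.
move=> /andP[q0 q1] step; elim=> [|m IH].
  by rewrite expr0 mul1r subrr !mul0r addr0.
apply: le_trans (step m) _; have := ler_wpM2l q0 IH.
have -> : q ^+ m.+1 * x 0 + (1 - q ^+ m.+1) / (1 - q) * a =
    q * (q ^+ m * x 0 + (1 - q ^+ m) / (1 - q) * a) + a.
  by rewrite exprS; field; rewrite subr_eq0 gt_eqF.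
by rewrite lerD2r.
Qed.

(* If [b] is the distance after the target has drifted by at most [c], its
   square grows by at most [(2 r - c) c]; the case [b < c] uses [c <= r]. *)
Lemma drift_sqr_le (a b c r : R) : 0 <= a -> 0 <= b -> 0 <= c <= r ->
  b <= a + c -> b <= r -> b ^+ 2 <= a ^+ 2 + (2 * r - c) * c.
Proof.
move=> a0 b0 /andP[c0 cr] bac br; have [cb|bc] := leP c b.
  have : (b - c) ^+ 2 <= a ^+ 2 by rewrite ler_sqr ?nnegrE //; lra.
  have := mulr_ge0 c0 (_ : 0 <= r - b); rewrite subr_ge0 => /(_ br).
  lra.
have : b ^+ 2 <= c ^+ 2 by rewrite ler_sqr ?nnegrE // ltW.
have := mulr_ge0 c0 (_ : 0 <= r - c); rewrite subr_ge0 => /(_ cr).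
have := sqr_ge0 a; lra.
Qed.

(** Bound the limit superior by the supremum over a tail on which the geometric term is below a
    given e. *)
Lemma limn_esup_geometric_le (x : nat -> R) (q B L : R) (t0 : nat) :
  0 <= q < 1 -> 0 <= B ->
  (forall t, (t0 < t)%N -> x t <= q ^+ (t - t0) * B + L) ->
  (limn_esup (fun t => (x t)%:E) <= L%:E)%E.
Proof.
move=> /andP[q0 q1] B0 xB; apply/lee_addgt0Pr => e e0.
have qB : ((fun m => q ^+ m * B) @ \oo --> (0 : R))%classic.
  rewrite -[X in (_ --> X)%classic](mul0r B); apply: cvgMl.
  by apply: cvg_expr; rewrite ger0_norm.
have [N _ HN] : (\forall m \near \oo, q ^+ m * B < e)%classic.
  exact: (cvgr_lt _ qB _ e0).
pose V := [set t | (t0 + N < t)%N]%classic.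
apply: (@le_trans _ _ (ereal_sup ((fun t => (x t)%:E) @` V))%classic).
  by apply: ereal_inf_lbound; exists V => //; exists (t0 + N).+1.
apply: ge_ereal_sup => _ [t /= t_gt <-]; rewrite -EFinD lee_fin.
have tt0 : (t0 < t)%N by apply: leq_ltn_trans t_gt; exact: leq_addr.
apply: le_trans (xB t tt0) _; rewrite addrC lerD2l; apply/ltW/HN => /=.
by rewrite leq_subRL ?(ltnW tt0) // ltnW.
Qed.

End Recursion.

(** * Assembly of the tracking bound *)

Theorem theorem1 (R : realType) (n d : nat) (hd : (1 <= d)%N) (hdn : (d <= n)%N)
    (U : nat -> Gr R n d) (u : nat -> 'cV[R]_n)
    (t0 : nat) (ht0 : (d <= t0)%N) (Uhat : nat -> Gr R n d)
    (T : nat) (hT : (d <= T <= t0.+1)%N) (K : nat) (hK : (1 <= K)%N)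
    (eps : R) (heps : 0 <= eps)
    (A1 : forall t : nat, (1 <= t)%N ->
       exists ubar e : 'cV[R]_n,
         [/\ u t = ubar + e, ubar \in val (U t) & frob e <= eps])
    (c : R) (hc : 0 <= c)
    (A2 : forall t : nat, (1 <= t)%N -> d2 (U t) (U t.+1) <= c)
    (sigmin sigmax : R) (hsig : 0 < sigmin <= sigmax)
    (A3 : forall t : nat, (T <= t)%N ->
       singular_value (gr_proj (U t) *m window u T t) 1 <= sigmax /\
       singular_value (gr_proj (U t) *m window u T t) d >= sigmin)
    (alpha : R) (halpha : 0 < alpha < sigmin ^+ 2 / (2 * sigmax ^+ 4))
    (rb : R) (hrb : c <= rb < 1)
    (A4_init : gr_ball rb (U t0.+1) (Uhat t0))
    (A4_rate : 0 <= contraction_rate alpha sigmin sigmax rb)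
    (A4_noise : forall t : nat, (t0 <= t)%N -> (T <= t)%N ->
       gamma_noise alpha sigmax rb (delta_noise u T c eps t) <=
         (1 - contraction_rate alpha sigmin sigmax rb) * rb ^+ 2 +
         (1 - contraction_rate alpha sigmin sigmax rb) * (c ^+ 2 - 2 * c * rb) /
           (1 - contraction_rate alpha sigmin sigmax rb ^+ K))
    (hGREAT : GREAT_output u T K alpha t0 Uhat) :
  let rho := contraction_rate alpha sigmin sigmax rb in
  let gam := gamma_noise alpha sigmax rb (delta_noise_sup u T c eps) in
  [/\ 0 < rho < 1,
      forall t : nat, (t0.+1 <= t)%N ->
        d2 (Uhat t) (U t) ^+ 2 <=
          rho ^+ (K * (t - t0)) * d2 (Uhat t0) (U t0) ^+ 2
          + (1 - rho ^+ (K * (t - t0))) / (1 - rho) * gam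
          + (1 - rho ^+ (K * (t - t0))) / (1 - rho ^+ K)
            * rho ^+ K * (2 * rb - c) * c
    & (limn_esup (fun t : nat => (d2 (Uhat t) (U t) ^+ 2)%:E) <=
        (1 / (1 - rho) * gam
         + rho ^+ K / (1 - rho ^+ K) * (2 * rb - c) * c)%:E)%E].
Proof.
move=> rho gam; rewrite -/rho in A4_rate A4_noise.
have /andP[cr r1] := hrb; have r0 : 0 <= rb by exact: le_trans cr.
have hr : 0 <= rb < 1 by rewrite r0.
have hcr : 0 <= c <= rb by rewrite hc.
have [/andP[smin0 le_s] /andP[a0 _] /andP[dT Tt0]] := And3 hsig halpha hT.
have smax0 : 0 <= sigmax by rewrite (le_trans (ltW smin0)).
have T1 : (1 <= T)%N by exact: leq_trans dT.
have rho_gt0 : 0 < rho := contraction_rate_gt0 hsig halpha hr.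
have rho_lt1 : rho < 1 := contraction_rate_lt1 hsig halpha hr.
have rho01 : 0 < rho < 1 by rewrite rho_gt0.
have rhoK_ge0 : 0 <= rho ^+ K by rewrite exprn_ge0 // ltW.
have rhoK_lt1 : rho ^+ K < 1 by rewrite exprn_ilt1 ?ltW // -lt0n.
have op_max t : (T <= t)%N -> op_le sigmax (gr_proj (U t) *m window u T t).
  by move=> Tt; apply: singular_value1_op_le; case: (A3 t Tt).
have op_min t : (T <= t)%N -> forall y : 'cV_n,
    sigmin * frob (gr_proj (U t) *m y) <=
    frob ((gr_proj (U t) *m window u T t)^T *m y).
  (* With P = M M^T and P W = M (M^T W), the d-th singular value bounds (M^T W)^T from below at M^T
     y, whose norm is that of P y. *)
  move=> Tt y; have [_ smin_le] := A3 t Tt.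
  have [M MU] := orthonormal_rep_exists (U t).
  move: smin_le; rewrite (gr_projE MU) -!mulmxA (isometry_frob _ MU.1) => smin_le.
  have := singular_value_lower MU.1 smin0 smin_le (M^T *m y).
  by rewrite (trmx_mul M) -mulmxA.
pose g t := gamma_noise alpha sigmax rb (delta_noise u T c eps t).
have delta0 t : 0 <= delta_noise u T c eps t by exact: delta_noise_ge0.
have g_le t : (T <= t)%N -> g t <= gam.
  move=> Tt; apply: gamma_noise_le; rewrite ?(ltW a0) // delta0 /=.
  exact: (delta_noise_le_sup heps hc A1 T1 op_max).
have gam_ge0 : 0 <= gam.
  have g00 : gamma_noise alpha sigmax rb 0 = 0 by rewrite /gamma_noise; ring.
  rewrite -g00; apply: gamma_noise_le; rewrite ?(ltW a0) // lexx /=.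
  apply: le_trans (delta0 T) _; exact: (delta_noise_le_sup heps hc A1 T1 op_max).
have sc_le0 : c ^+ 2 - 2 * c * rb <= 0.
  have := mulr_ge0 hc (_ : 0 <= rb - c); rewrite subr_ge0 => /(_ cr).
  have := mulr_ge0 hc r0; lra.
(* As c <= rb, the correction term in [A4_noise] is nonpositive; without it the condition makes the
   ball invariant under the inner loop. *)
have g_rb t : (t0 < t)%N -> g t <= (1 - rho) * rb ^+ 2.
  move=> tt0; apply: le_trans (A4_noise t (ltnW tt0) (leq_trans Tt0 tt0)) _.
  rewrite gerDl pmulr_lle0 ?invr_gt0 ?subr_gt0 //.
  by rewrite pmulr_rle0 ?subr_gt0.
have inner t : (t0 < t)%N -> d2 (Uhat t.-1) (U t) <= rb ->
    d2 (Uhat t) (U t) ^+ 2 <= rho ^+ K * d2 (Uhat t.-1) (U t) ^+ 2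
      + (1 - rho ^+ K) / (1 - rho) * g t.
  move=> tt0 Ut_rb; have [G [G0 Gstep ->]] := hGREAT t tt0; rewrite -G0.
  have Tt : (T <= t)%N by exact: leq_trans tt0.
  have [] := @inner_recursion R (fun k => d2 (G k) (U t) ^+ 2) K rho (g t)
    (rb ^+ 2) rho01 _ (g_rb t tt0) _ K (leqnn K); last by [].
    by rewrite G0 ler_sqr ?nnegrE ?d2_ge0.
  move=> k kK zk; apply: (gradient_step_d2 hsig halpha hr (op_max t Tt)
    (op_min t Tt) _ (g_rb t tt0)).
  - by apply: (window_noise_le heps hc A1 A2); rewrite T1.
  - exact: Gstep.
  - by rewrite -ler_sqr ?nnegrE ?d2_ge0.
have drift t : (1 <= t)%N -> d2 (Uhat t) (U t.+1) <= d2 (Uhat t) (U t) + c.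
  by move=> t1; apply: le_trans (d2_triangle _ (U t) _) _; rewrite lerD2l A2.
(* After the inner loop the distance is at most rb - c, which leaves room for a drift of [c]. *)
have ball t : (t0 <= t)%N -> d2 (Uhat t) (U t.+1) <= rb.
  move=> /subnKC <-; elim: (t - t0)%N => [|k IH].
    by rewrite addn0 d2C in A4_init *.
  rewrite addnS; set s := (t0 + k).+1 in IH *.
  apply: le_trans (drift s _) _ => //; rewrite -lerBrDr.
  rewrite -ler_sqr ?nnegrE ?d2_ge0 ?subr_ge0 //.
  have ts : (t0 < s)%N by rewrite ltnS leq_addr.
  apply: le_trans (inner s ts IH) _.
  have y_le : d2 (Uhat s.-1) (U s) ^+ 2 <= rb ^+ 2 by rewrite ler_sqr ?nnegrE ?d2_ge0.
  have gs := A4_noise s (ltnW ts) (leq_trans Tt0 ts).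
  have w0 : 0 <= (1 - rho ^+ K) / (1 - rho) by rewrite divr_ge0 // subr_ge0 ltW.
  (* The right side is exactly rb^2 + c^2 - 2 c rb = (rb - c)^2. *)
  have := lerD (ler_wpM2l rhoK_ge0 y_le) (ler_wpM2l w0 gs).
  move=> /le_trans; apply; rewrite le_eqVlt; apply/orP; left; apply/eqP.
  by field; rewrite !subr_eq0 !gt_eqF.
have main t : (t0 <= t)%N -> d2 (Uhat t) (U t) ^+ 2 <=
    rho ^+ (K * (t - t0)) * d2 (Uhat t0) (U t0) ^+ 2
    + (1 - rho ^+ (K * (t - t0))) / (1 - rho) * gam
    + (1 - rho ^+ (K * (t - t0))) / (1 - rho ^+ K)
      * rho ^+ K * (2 * rb - c) * c.
  move=> tt0.
  (* Growth per sample: the noise of [K] inner steps, plus the drift, which precedes these steps and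
     is thus contracted by rho^K. *)
  pose a := (1 - rho ^+ K) / (1 - rho) * gam + rho ^+ K * ((2 * rb - c) * c).
  have := @outer_recursion R (fun m => d2 (Uhat (t0 + m)%N) (U (t0 + m)%N) ^+ 2)
    (rho ^+ K) a _ _ (t - t0)%N.
  rewrite addn0 subnKC // -!exprM => H.
  apply: le_trans (H _ _) _; last 1 first.
  - rewrite le_eqVlt; apply/orP; left; apply/eqP; rewrite /a.
    by field; rewrite !subr_eq0 !gt_eqF.
  - by rewrite rhoK_ge0.
  move=> m; rewrite addnS; set s := (t0 + m)%N.
  have t0s : (t0 <= s)%N by exact: leq_addr.
  have s1 : (1 <= s)%N by exact: leq_trans (leq_trans hd ht0) t0s.
  apply: le_trans (inner s.+1 t0s (ball s t0s)) _; rewrite /a /=.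
  have w0 : 0 <= (1 - rho ^+ K) / (1 - rho) by rewrite divr_ge0 // subr_ge0 ltW.
  have y_le := drift_sqr_le (d2_ge0 _ _) (d2_ge0 _ _) hcr (drift s s1) (ball s t0s).
  have gs := g_le s.+1 (leq_trans Tt0 (t0s : (t0 < s.+1)%N)).
  apply: le_trans (lerD (ler_wpM2l rhoK_ge0 y_le) (ler_wpM2l w0 gs)) _.
  by rewrite mulrDr -addrA lerD2l addrC.
split=> //; first by move=> t /ltnW/main.
apply: (limn_esup_geometric_le (q := rho ^+ K)
  (B := d2 (Uhat t0) (U t0) ^+ 2) (t0 := t0)).
- by rewrite rhoK_ge0.
- exact: sqr_ge0.
(* Bounding the factors 1 - rho^(K (t - t0)) by 1 leaves one geometric term and a constant. *)
move=> t tt0; apply: le_trans (main t (ltnW tt0)) _.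
rewrite -exprM -addrA lerD2l; apply: lerD.
  rewrite ler_wpM2r // ler_wpM2r ?invr_ge0 ?subr_ge0 ?(ltW rho_lt1) //.
  by rewrite gerBl exprn_ge0 // ltW.
have rc_ge0 : 0 <= 2 * rb - c by rewrite subr_ge0 (le_trans cr) // ler_peMl // ler1n.
rewrite ler_wpM2r // ler_wpM2r // mulrAC.
rewrite ler_wpM2r ?invr_ge0 ?subr_ge0 ?(ltW rhoK_lt1) // ler_piMl //.
by rewrite gerBl exprn_ge0 // ltW.
Qed.
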